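(* Let $F$ be a multiplicatively Archimedean fully preordered semifield with a power universal element $u>1$ such that: \begin{itemize} \item $F$ is of arctic type. \item $F/\!\sim$ has quasi-complements. \item $(F/\!\sim)\otimes\mathbb{Z}$ is a finite product of fields. \end{itemize} Then there exists a homomorphism $\psi:F\to\mathbb{R}_{(+)}[X]/(X^2)$ such that for all $x\sim y$ in $F$, we have \[ x\le y\quad\Longleftrightarrow\quad\psi(x)\le\psi(y). \] Moreover, if $F$ is also a semialgebra, then $\psi$ can be chosen so as to preserve scalar multiplication by $\mathbb{R}_+$.
   Context: All semirings are commutative with $0$ (absorbing) and $1$, and homomorphisms are semiring homomorphisms; $\mathbb{N}\ni0$, and $n\in\mathbb{N}$ also denotes the element $n\cdot1$ of a semiring. A semifield is a semiring $F$ whose multiplicatively invertible elements are exactly the nonzero ones; $F^\times=F\setminus\{0\}$. For a preorder $\le$: $x\approx y$ means $x\le y$ and $y\le x$; $x<y$ means $x\le y$ and not $y\le x$; $\sim$ is the equivalence relation generated by $\le$. A preordered semifield is a semifield with a preorder such that addition by $a$ and multiplication by $a$ are monotone for every $a$, and such that $x\approx0$ implies $x=0$. $F/\!\sim$ is the quotient semiring. The preorder is full (and $F$ is fully preordered) if $x\sim y$ implies $x\le y$ or $x\ge y$. $F$ is multiplicatively Archimedean if for all $x,y\in F^\times$: if $x^k\le y$ for all $k\in\mathbb{N}$, then $x\le1$. A power universal element is a nonzero $u\in F$ with $1\le u$ such that for all nonzero $x\le y$ in $F$ there is $k\in\mathbb{N}$ with $y\le xu^k$. $F$ is arctic if $x+x^{-1}\approx2$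 for all $x\in F^\times$ with $x>1$. A semiring $T$ has quasi-complements if for every $x\in T$ there are $y\in T$ and $n\in\mathbb{N}$ with $x+y=n$. For a semiring $T$, $T\otimes\mathbb{Z}$ is the commutative ring generated by $T$ (Grothendieck construction: formal differences of elements of $T$). The empty product of fields (the zero ring) counts as a finite product of fields. $\mathbb{R}_{(+)}[X]/(X^2)$ is the preordered semifield whose elements are the linear polynomials $r+sX$ modulo $X^2$ with $r,s\in\mathbb{R}$ and either $r>0$ or $r=s=0$, with the usual addition and multiplication modulo $X^2$, and with preorder $r_1+s_1X\le r_2+s_2X$ if and only if $r_1=r_2$ and $s_1\le s_2$. A semialgebra is a semiring $S$ with a scalar multiplication $\mathbb{R}_+\times S\to S$ which is a commutative monoid homomorphism (for addition) in each argument and satisfies $1x=x$ and $(rx)(sy)=(rs)(xy)$. The scalar multiplication on $\mathbb{R}_{(+)}[X]/(X^2)$ is the usual one. *)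

(* Defs.v *)
From HB Require Import structures.
From mathcomp Require Import all_boot all_order all_algebra.
From mathcomp Require Import boolp reals.
From Stdlib Require Relation_Definitions Relation_Operators.

Set Implicit Arguments.
Unset Strict Implicit.
Unset Printing Implicit Defensive.

Import Order.TTheory GRing.Theory Num.Theory.

Local Open Scope ring_scope.
Local Open Scope quotient_scope.

HB.mixin Record ComPzSemiRing_isSemifield F of GRing.ComPzSemiRing F := {
  semifield_unitP : forall x : F, (exists y : F, x * y = 1) <-> x <> 0
}.

#[short(type="semifieldType")]
HB.structure Definition Semifield :=
  { F of GRing.ComPzSemiRing F & ComPzSemiRing_isSemifield F }.

(* [Order.Preorder] is not used for the preorder because the algebraic
   hierarchy has no join of [Order.Preorder] with [nmodType] below the
   antisymmetric [porderZmodType]. *)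
HB.mixin Record Semifield_isPreordered F of Semifield F := {
  ple : F -> F -> Prop;
  ple_preorder : Relation_Definitions.preorder F ple;
  pleD2l : forall a x y : F, ple x y -> ple (a + x) (a + y);
  pleM2l : forall a x y : F, ple x y -> ple (a * x) (a * y);
  ple_approx0 : forall x : F, ple x 0 -> ple 0 x -> x = 0
}.

#[short(type="preorderedSemifieldType")]
HB.structure Definition PreorderedSemifield :=
  { F of Semifield F & Semifield_isPreordered F }.

Definition plt (F : preorderedSemifieldType) (x y : F) : Prop :=
  ple x y /\ ~ ple y x.

Notation "x [<=] y" := (ple x y) (at level 70, no associativity) : ring_scope.
Notation "x [<] y" := (plt x y) (at level 70, no associativity) : ring_scope.

Section Preordered.
Variable F : preorderedSemifieldType.
Implicit Types x y u : F.

Definition approx x y : Prop := x [<=] y /\ y [<=] x.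

Definition sim : F -> F -> Prop := Relation_Operators.clos_refl_sym_trans F ple.

Definition fully_preordered : Prop :=
  forall x y, sim x y -> x [<=] y \/ y [<=] x.

Definition mult_archimedean : Prop :=
  forall x y, x <> 0 -> y <> 0 -> (forall k : nat, x ^+ k [<=] y) -> x [<=] 1.

Definition power_universal u : Prop :=
  [/\ u <> 0, 1 [<=] u &
      forall x y, x <> 0 -> y <> 0 -> x [<=] y ->
        exists k : nat, y [<=] x * u ^+ k].

(* [x'] is the inverse of [x]; its existence makes [x] nonzero. *)
Definition arctic : Prop :=
  forall x x', x * x' = 1 -> 1 [<] x -> approx (x + x') 2%:R.

End Preordered.

Section SimQuotient.
Variable F : preorderedSemifieldType.
Implicit Types x y z : F.

Lemma sim_refl x : sim x x.
Proof. exact: Relation_Operators.rst_refl. Qed.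

Lemma sim_sym x y : sim x y -> sim y x.
Proof. exact: Relation_Operators.rst_sym. Qed.

Lemma sim_trans y x z : sim x y -> sim y z -> sim x z.
Proof. exact: Relation_Operators.rst_trans. Qed.

Lemma sim_congr (f : F -> F) : {homo f : x y / x [<=] y} ->
  forall x y, sim x y -> sim (f x) (f y).
Proof.
move=> fle x y; elim=> [{}x {}y|{}x|{}x {}y _|{}x {}y z _ IH1 _ IH2].
- by move=> /fle; exact: Relation_Operators.rst_step.
- exact: sim_refl.
- exact: sim_sym.
- exact: sim_trans IH1 IH2.
Qed.

Lemma simD x x' y y' : sim x x' -> sim y y' -> sim (x + y) (x' + y').
Proof.
move=> sx sy; apply: (@sim_trans (x + y')).
  by apply: (sim_congr (pleD2l x)).
by rewrite -!(addrC y'); apply: (sim_congr (pleD2l y')).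
Qed.

Lemma simM x x' y y' : sim x x' -> sim y y' -> sim (x * y) (x' * y').
Proof.
move=> sx sy; apply: (@sim_trans (x * y')).
  by apply: (sim_congr (pleM2l x)).
by rewrite -!(mulrC y'); apply: (sim_congr (pleM2l y')).
Qed.

Definition simb x y : bool := `[< sim x y >].

Lemma simb_refl : reflexive simb.
Proof. by move=> x; apply/asboolP; exact: sim_refl. Qed.

Lemma simb_sym : symmetric simb.
Proof. by move=> x y; apply/asboolP/asboolP; exact: sim_sym. Qed.

Lemma simb_trans : transitive simb.
Proof.
by move=> y x z /asboolP xy /asboolP yz; apply/asboolP; exact: sim_trans yz.
Qed.

Canonical simb_equiv := EquivRel simb simb_refl simb_sym simb_trans.

Definition sim_quot := {eq_quot simb_equiv}.

HB.instance Definition _ := Choice.on sim_quot.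
HB.instance Definition _ := EqQuotient.on sim_quot.

Lemma sim_piP x y : \pi_sim_quot x = \pi_sim_quot y <-> sim x y.
Proof.
split=> [/eqquotP/asboolP //|xy]; apply/eqquotP; exact/asboolP.
Qed.

Lemma sim_repr x : sim (repr (\pi_sim_quot x)) x.
Proof. by apply/sim_piP; rewrite reprK. Qed.

Definition sq_add := lift_op2 sim_quot +%R.
Definition sq_mul := lift_op2 sim_quot *%R.

Lemma sq_addE x y :
  sq_add (\pi_sim_quot x) (\pi_sim_quot y) = \pi_sim_quot (x + y).
Proof. by unlock sq_add; apply/sim_piP/simD; exact: sim_repr. Qed.

Lemma sq_mulE x y :
  sq_mul (\pi_sim_quot x) (\pi_sim_quot y) = \pi_sim_quot (x * y).
Proof. by unlock sq_mul; apply/sim_piP/simM; exact: sim_repr. Qed.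

Lemma sq_addA : associative sq_add.
Proof.
by elim/quotW=> x; elim/quotW=> y; elim/quotW=> z;
  rewrite !sq_addE addrA.
Qed.
Lemma sq_addC : commutative sq_add.
Proof. by elim/quotW=> x; elim/quotW=> y; rewrite !sq_addE addrC. Qed.
Lemma sq_add0 : left_id (\pi_sim_quot 0) sq_add.
Proof. by elim/quotW=> x; rewrite sq_addE add0r. Qed.
Lemma sq_mulA : associative sq_mul.
Proof.
by elim/quotW=> x; elim/quotW=> y; elim/quotW=> z;
  rewrite !sq_mulE mulrA.
Qed.
Lemma sq_mulC : commutative sq_mul.
Proof. by elim/quotW=> x; elim/quotW=> y; rewrite !sq_mulE mulrC. Qed.
Lemma sq_mul1 : left_id (\pi_sim_quot 1) sq_mul.
Proof. by elim/quotW=> x; rewrite sq_mulE mul1r. Qed.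
Lemma sq_mulDl : left_distributive sq_mul sq_add.
Proof.
elim/quotW=> x; elim/quotW=> y; elim/quotW=> z.
by rewrite sq_addE !sq_mulE sq_addE mulrDl.
Qed.
Lemma sq_mul0 : left_zero (\pi_sim_quot 0) sq_mul.
Proof. by elim/quotW=> x; rewrite sq_mulE mul0r. Qed.

HB.instance Definition _ :=
  GRing.isNmodule.Build sim_quot sq_addA sq_addC sq_add0.
HB.instance Definition _ := GRing.Nmodule_isComPzSemiRing.Build sim_quot
  sq_mulA sq_mulC sq_mul1 sq_mulDl sq_mul0.

Lemma sim_piD x y : \pi_sim_quot (x + y) = \pi_sim_quot x + \pi_sim_quot y.
Proof. by rewrite -sq_addE. Qed.
Lemma sim_piM x y : \pi_sim_quot (x * y) = \pi_sim_quot x * \pi_sim_quot y.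
Proof. by rewrite -sq_mulE. Qed.
Lemma sim_pi0 : \pi_sim_quot 0 = 0.
Proof. by []. Qed.
Lemma sim_pi1 : \pi_sim_quot 1 = 1.
Proof. by []. Qed.

End SimQuotient.

Definition quasi_complements (T : comPzSemiRingType) : Prop :=
  forall x : T, exists (y : T) (n : nat), x + y = n%:R.

Section Grothendieck.
Variable T : comPzSemiRingType.
Implicit Types p q r : T * T.

(* The pair [p] stands for the formal difference [p.1 - p.2]; the extra
   summand is needed because addition in [T] need not be cancellative. *)
Definition gr_rel p q : Prop :=
  exists k : T, p.1 + q.2 + k = q.1 + p.2 + k.

Lemma gr_refl p : gr_rel p p.
Proof. by exists 0. Qed.

Lemma gr_sym p q : gr_rel p q -> gr_rel q p.
Proof. by case=> k e; exists k. Qed.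

Lemma gr_trans q p r : gr_rel p q -> gr_rel q r -> gr_rel p r.
Proof.
case: p q r => [a b] [c d] [e f] [k /= h1] [l /= h2].
exists (c + d + k + l).
have -> : a + f + (c + d + k + l) = (a + d + k) + (c + f + l).
  by rewrite [LHS](AC (2*4) ((1*4*5)*(3*2*6))).
by rewrite h1 h2 [LHS](AC (3*3) ((4*2)*(1*5*3*6))).
Qed.

Definition grb p q : bool := `[< gr_rel p q >].

Lemma grb_refl : reflexive grb.
Proof. by move=> x; apply/asboolP; exact: gr_refl. Qed.

Lemma grb_sym : symmetric grb.
Proof. by move=> x y; apply/asboolP/asboolP; exact: gr_sym. Qed.

Lemma grb_trans : transitive grb.
Proof.
by move=> y x z /asboolP xy /asboolP yz; apply/asboolP; exact: gr_trans yz.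
Qed.

Canonical grb_equiv := EquivRel grb grb_refl grb_sym grb_trans.

Definition groth := {eq_quot grb_equiv}.

HB.instance Definition _ := Choice.on groth.
HB.instance Definition _ := EqQuotient.on groth.

Lemma gr_piP p q : \pi_groth p = \pi_groth q <-> gr_rel p q.
Proof.
split=> [/eqquotP/asboolP //|xy]; apply/eqquotP; exact/asboolP.
Qed.

Lemma gr_repr p : gr_rel (repr (\pi_groth p)) p.
Proof. by apply/gr_piP; rewrite reprK. Qed.

Definition pr_add p q : T * T := (p.1 + q.1, p.2 + q.2).
Definition pr_opp p : T * T := (p.2, p.1).
Definition pr_mul p q : T * T :=
  (p.1 * q.1 + p.2 * q.2, p.1 * q.2 + p.2 * q.1).

Lemma pr_addC : commutative pr_add.
Proof. by move=> p q; congr pair; exact: addrC. Qed.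
Lemma pr_mulC : commutative pr_mul.
Proof.
move=> [a b] [c d]; rewrite /pr_mul /= (mulrC a) (mulrC b) (mulrC a) (mulrC b).
by rewrite (addrC (d * a)).
Qed.

Lemma gr_rel_addl p q r : gr_rel p q -> gr_rel (pr_add p r) (pr_add q r).
Proof.
case: p q r => [a b] [c d] [e f] [k /= h]; exists (k + e + f) => /=.
have -> : a + e + (d + f) + (k + e + f) = (a + d + k) + (e + f + e + f).
  by rewrite [LHS](AC (2*2*3) ((1*3*5)*(2*4*6*7))).
by rewrite h [LHS](AC (3*4) ((1*4)*(2*5)*(3*6*7))).
Qed.

Lemma gr_rel_opp p q : gr_rel p q -> gr_rel (pr_opp p) (pr_opp q).
Proof.
by case=> k h; exists k; rewrite /pr_opp /= addrC [b in _ = b]addrC addrC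
  (addrC p.2) (addrC q.2) -h addrC.
Qed.

Lemma gr_rel_mull p q r : gr_rel p q -> gr_rel (pr_mul p r) (pr_mul q r).
Proof.
case: p q r => [a b] [c d] [e f] [k /= h]; exists (k * e + k * f) => /=.
have -> : a * e + b * f + (c * f + d * e) + (k * e + k * f)
    = (a + d + k) * e + (c + b + k) * f.
  by rewrite !mulrDl [LHS](AC (2*2*2) ((1*4*5)*(3*2*6))).
rewrite h -{2}h !mulrDl [LHS](AC (3*3) ((1*5)*(4*2)*(3*6))).
by [].
Qed.

Definition gr_add := lift_op2 groth pr_add.
Definition gr_opp := lift_op1 groth pr_opp.
Definition gr_mul := lift_op2 groth pr_mul.

Lemma gr_addE p q : gr_add (\pi_groth p) (\pi_groth q) = \pi_groth (pr_add p q).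
Proof.
unlock gr_add; apply/gr_piP; apply: (gr_trans (gr_rel_addl _ (gr_repr p))).
rewrite -!(pr_addC (repr _)) -!(pr_addC q) !(pr_addC _ p).
rewrite !(pr_addC p); exact: gr_rel_addl (gr_repr q).
Qed.

Lemma gr_oppE p : gr_opp (\pi_groth p) = \pi_groth (pr_opp p).
Proof. by unlock gr_opp; apply/gr_piP/gr_rel_opp; exact: gr_repr. Qed.

Lemma gr_mulE p q : gr_mul (\pi_groth p) (\pi_groth q) = \pi_groth (pr_mul p q).
Proof.
unlock gr_mul; apply/gr_piP; apply: (gr_trans (gr_rel_mull _ (gr_repr p))).
rewrite !(pr_mulC p); exact: gr_rel_mull (gr_repr q).
Qed.

Lemma gr_addA : associative gr_add.
Proof.
elim/quotW=> x; elim/quotW=> y; elim/quotW=> z;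
  rewrite !gr_addE.
by congr (\pi_groth _); congr pair; exact: addrA.
Qed.
Lemma gr_addC : commutative gr_add.
Proof. by elim/quotW=> x; elim/quotW=> y; rewrite !gr_addE pr_addC. Qed.
Lemma gr_add0 : left_id (\pi_groth (0, 0)) gr_add.
Proof.
elim/quotW=> -[x y]; rewrite gr_addE.
by congr (\pi_groth _); congr pair; exact: add0r.
Qed.
Lemma gr_addN : left_inverse (\pi_groth (0, 0)) gr_opp gr_add.
Proof.
elim/quotW=> -[x y]; rewrite gr_oppE gr_addE; apply/gr_piP.
by exists 0; rewrite /= !addr0 add0r addrC.
Qed.
Lemma gr_mulA : associative gr_mul.
Proof.
elim/quotW=> -[a b]; elim/quotW=> -[c d]; elim/quotW=> -[e f].
rewrite !gr_mulE; congr (\pi_groth _); rewrite /pr_mul /= !mulrDr !mulrDl !mulrA.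
by congr pair; rewrite [LHS](AC (2*2) ((1*4)*(2*3))) // (AC (2*2) ((1*3)*(4*2))).
Qed.
Lemma gr_mulC : commutative gr_mul.
Proof. by elim/quotW=> x; elim/quotW=> y; rewrite !gr_mulE pr_mulC. Qed.
Lemma gr_mul1 : left_id (\pi_groth (1, 0)) gr_mul.
Proof.
elim/quotW=> -[x y]; rewrite gr_mulE /pr_mul /=.
by rewrite !mul1r !mul0r !addr0.
Qed.
Lemma gr_mulDl : left_distributive gr_mul gr_add.
Proof.
elim/quotW=> -[a b]; elim/quotW=> -[c d]; elim/quotW=> -[e f].
rewrite gr_addE !gr_mulE gr_addE; congr (\pi_groth _); rewrite /pr_mul /pr_add /=.
by rewrite !mulrDl; congr pair; rewrite [LHS](AC (2*2) ((1*3)*(2*4))).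
Qed.

HB.instance Definition _ :=
  GRing.isZmodule.Build groth gr_addA gr_addC gr_add0 gr_addN.
HB.instance Definition _ := GRing.Zmodule_isComPzRing.Build groth
  gr_mulA gr_mulC gr_mul1 gr_mulDl.

End Grothendieck.

(* A ring homomorphism to a product of rings is a family of homomorphisms to
   the factors, so this says that [A] is isomorphic to the product of the
   [K i]; for [n = 0] it says that [A] is the zero ring. *)
Definition finite_product_of_fields (A : comPzRingType) : Prop :=
  exists (n : nat) (K : 'I_n -> fieldType) (p : forall i, {rmorphism A -> K i}),
    bijective (fun a : A => (fun i => p i a) : forall i, K i).

Section NonnegReals.
Variable R : realType.

Definition nnreal := {r : R | r \is Num.nneg}.

HB.instance Definition _ := SubChoice.on nnreal.

Lemma nnreal_semiring_closed : semiring_closed (Num.nneg : {pred R}).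
Proof.
split; split=> [|x y]; rewrite ?rpred0 ?rpred1 //.
  exact: rpredD.
exact: rpredM.
Qed.

HB.instance Definition _ := GRing.SubChoice_isSubComNzSemiRing.Build R _ nnreal
  nnreal_semiring_closed.

Record is_semialgebra (S : comPzSemiRingType) (scal : nnreal -> S -> S) : Prop :=
  IsSemialgebra {
    scal0l : forall x, scal 0 x = 0;
    scalDl : forall r s x, scal (r + s) x = scal r x + scal s x;
    scal0r : forall r, scal r 0 = 0;
    scalDr : forall r x y, scal r (x + y) = scal r x + scal r y;
    scal1 : forall x, scal 1 x = x;
    scalM : forall r s x y, scal r x * scal s y = scal (r * s) (x * y)
  }.

End NonnegReals.

Section LinPoly.
Variable R : realType.

(* R[X]/(X^2); every class is represented by the polynomial [r + s X] with
   [r] and [s] its coefficients [p`_0] and [p`_1]. *)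
Definition dualnum := {poly %/ ('X^2 : {poly R})}.

HB.instance Definition _ := GRing.ComNzRing.on dualnum.
HB.instance Definition _ := GRing.Lmodule.on dualnum.

Implicit Types p q : dualnum.

Lemma dualP p q : p`_0 = q`_0 -> p`_1 = q`_1 -> p = q.
Proof.
move=> e0 e1; apply/npolyP => -[|[|i]] //.
by rewrite !big_coef_npoly // mk_monic_Xn size_polyXn.
Qed.

Lemma dualD p q i : (p + q)`_i = p`_i + q`_i.
Proof. exact: coefD. Qed.

Lemma dualZ (r : R) p i : (r *: p)`_i = r * p`_i.
Proof. exact: coefZ. Qed.

Lemma dual0 i : (0 : dualnum)`_i = 0.
Proof. exact: coef0. Qed.

Lemma dual1 i : (1 : dualnum)`_i = (i == 0)%:R.
Proof. exact: coef1. Qed.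

Lemma dualM p q i : (i < 2)%N -> (p * q)`_i = ((p : {poly R}) * q)`_i.
Proof.
move=> i2; pose s : {poly R} := (p : {poly R}) * q.
have -> : (p * q)`_i = (Pdiv.CommonRing.rmodp s (mk_monic 'X^2))`_i by [].
have mX : ('X^2 : {poly R}) \is monic by rewrite monicXn.
rewrite -/s; move: s => s; rewrite mk_monic_Xn [in RHS](Pdiv.RingMonic.rdivp_eq mX s).
by rewrite coefD coefMXn i2 add0r.
Qed.

Lemma dualM0 p q : (p * q)`_0 = p`_0 * q`_0.
Proof. by rewrite dualM // coef0M. Qed.

Lemma dualM1 p q : (p * q)`_1 = p`_0 * q`_1 + p`_1 * q`_0.
Proof. by rewrite dualM // coefM !big_ord_recl big_ord0 addr0. Qed.

Definition linpoly_pred : {pred dualnum} := fun p => (0 < p`_0) || (p == 0).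

Definition linpoly := {p : dualnum | linpoly_pred p}.

HB.instance Definition _ := SubChoice.on linpoly.

Lemma linpolyPred0 : linpoly_pred 0.
Proof. by rewrite /linpoly_pred eqxx orbT. Qed.

Lemma linpolyPredD p q : linpoly_pred p -> linpoly_pred q -> linpoly_pred (p + q).
Proof.
case/orP=> [p0|/eqP->]; last by rewrite add0r.
case/orP=> [q0|/eqP->]; last by rewrite addr0 /linpoly_pred p0.
by rewrite /linpoly_pred dualD addr_gt0.
Qed.

Lemma linpolyPredM p q : linpoly_pred p -> linpoly_pred q -> linpoly_pred (p * q).
Proof.
case/orP=> [p0|/eqP->]; last by rewrite mul0r linpolyPred0.
case/orP=> [q0|/eqP->]; last by rewrite mulr0 linpolyPred0.
by rewrite /linpoly_pred dualM0 mulr_gt0.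
Qed.

Lemma linpoly_semiring_closed : semiring_closed linpoly_pred.
Proof.
split; split; [exact: linpolyPred0 | exact: linpolyPredD | | exact: linpolyPredM].
by rewrite unfold_in /linpoly_pred dual1 ltr01.
Qed.

HB.instance Definition _ :=
  GRing.SubChoice_isSubComNzSemiRing.Build dualnum _ linpoly
    linpoly_semiring_closed.

Implicit Types x y z a : linpoly.

Definition linpoly_le x y : Prop :=
  (val x)`_0 = (val y)`_0 /\ (val x)`_1 <= (val y)`_1.

Lemma linpoly_le_preorder : Relation_Definitions.preorder linpoly linpoly_le.
Proof.
split=> [x|x y z [xy0 xy1] [yz0 yz1]]; first by split.
by split; [rewrite xy0 | exact: le_trans yz1].
Qed.

Lemma linpoly_ge0 x : 0 <= (val x)`_0.
Proof.
by have /orP[/ltW //|/eqP ->] := valP x; rewrite dual0.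
Qed.

Lemma linpoly_unitP x : (exists y, x * y = 1) <-> x <> 0.
Proof.
split=> [[y xy] x0|x0].
  by have /eqP := oner_neq0 linpoly; rewrite -xy x0 mul0r.
have px : 0 < (val x)`_0.
  by have /orP[//|/eqP x00] := valP x; case: x0; apply: val_inj.
set r := (val x)`_0 in px *; set s := (val x)`_1.
have rN0 : r != 0 by rewrite gt_eqF.
pose t : {poly R} := r^-1%:P - (s / r ^+ 2) *: 'X.
pose q : dualnum := in_qpoly 'X^2 t.
have st : (size t < size (mk_monic ('X^2 : {poly R})))%N.
  rewrite mk_monic_Xn size_polyXn ltnS (leq_trans (size_polyD _ _)) //.
  rewrite geq_max (leq_trans (size_polyC_leq1 _)) //= size_polyN.
  by rewrite (leq_trans (size_scale_leq _ _)) ?size_polyX.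
have q0 : q`_0 = r^-1.
  rewrite /q in_qpoly_small // /t coefB coefC coefZ coefX /=.
  by rewrite mulr0 subr0.
have q1 : q`_1 = - (s / r ^+ 2).
  rewrite /q in_qpoly_small // /t coefB coefC coefZ coefX /=.
  by rewrite mulr1 sub0r.
have qP : linpoly_pred q by rewrite /linpoly_pred q0 invr_gt0 px.
exists (Sub q qP); apply: val_inj; apply: dualP.
  by rewrite rmorphM rmorph1 SubK dualM0 dual1 q0 -/r divff.
rewrite rmorphM rmorph1 SubK dualM1 dual1 q0 q1 -/r -/s /=.
by rewrite mulrN expr2 invfM mulrCA (mulrA r) divff // mul1r addNr.
Qed.

Lemma linpoly_leD2l a x y : linpoly_le x y -> linpoly_le (a + x) (a + y).
Proof. by case=> h0 h1; split; rewrite !rmorphD !dualD ?h0 ?lerD2l. Qed.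

Lemma linpoly_leM2l a x y : linpoly_le x y -> linpoly_le (a * x) (a * y).
Proof.
case=> h0 h1; split; rewrite !rmorphM ?dualM0 ?dualM1 h0 //.
by rewrite lerD2r ler_wpM2l // linpoly_ge0.
Qed.

Lemma linpoly_le_approx0 x : linpoly_le x 0 -> linpoly_le 0 x -> x = 0.
Proof.
move=> [h0 h1] [_ h2]; apply: val_inj; apply: dualP => //.
by apply/eqP; rewrite eq_le h1 h2.
Qed.

HB.instance Definition _ := ComPzSemiRing_isSemifield.Build linpoly linpoly_unitP.
HB.instance Definition _ := Semifield_isPreordered.Build linpoly
  linpoly_le_preorder linpoly_leD2l linpoly_leM2l linpoly_le_approx0.

Lemma linpoly_scale_subproof (r : nnreal R) x :
  linpoly_pred (val r *: val x).
Proof.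
have /orP[x0|/eqP->] := valP x; last by rewrite scaler0 linpolyPred0.
have [->|rN0] := eqVneq (val r) 0; first by rewrite scale0r linpolyPred0.
have r0 : 0 <= val r by exact: (valP r).
by rewrite /linpoly_pred dualZ mulr_gt0 // lt_def rN0.
Qed.

Definition linpoly_scale (r : nnreal R) x : linpoly :=
  Sub (val r *: val x) (linpoly_scale_subproof r x).

Lemma linpoly_semialgebra : is_semialgebra linpoly_scale.
Proof.
split=> [x|r s x|r|r x y|x|r s x y]; apply: val_inj;
  rewrite /linpoly_scale ?(rmorphD, rmorphM, rmorph0, rmorph1, SubK).
- by rewrite scale0r.
- by rewrite scalerDl.
- by rewrite scaler0.
- by rewrite scalerDr.
- by rewrite scale1r.
- by rewrite -scalerAl -scalerAr scalerA.
Qed.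

End LinPoly.

(* Main.v *)
Require Import Defs.
From HB Require Import structures.
From mathcomp Require Import all_boot all_order all_algebra.
From mathcomp Require Import boolp reals ring lra zify classical_sets.
From Stdlib Require Import Setoid Morphisms.

Set Implicit Arguments.
Unset Strict Implicit.
Unset Printing Implicit Defensive.

Import Order.TTheory GRing.Theory Num.Theory.

Local Open Scope ring_scope.
Local Open Scope quotient_scope.

(** The theorem linearises the preorder of [F] on its classes modulo [sim].

    Let [A] be the Grothendieck ring of [F] and [I] the ideal of the differences
    [x - y] with [sim x y]; as the preorder is full, the differences with
    [y [<=] x] form a cone [C] with [I = C \/ - C].  With [~] for [approx],
    the arctic identity [x + x^-1 ~ 2] says that the arithmetic mean of [1] and [g]
    behaves like their geometric mean, whence [g h + 1 ~ g + h] for [g], [h] in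
    the class of [1] ([arctic_mulD1]): multiplication around [1] is, to first
    order, addition.  With quasi-complements this gives that addition can be cancelled
    ([ple_cancelD]), so that [C] determines the preorder, and that each element
    of [I] is, up to the preorder, of the form [g - 1] ([sim_approx_shift]).
    Hence [I] is an Archimedean ordered group, because the class of [1] is one
    under multiplication.

    Hoelder's theorem embeds such a group into the reals, and the embedding
    [ell] is unique up to a scalar.  Multiplication by [x] preserves [C], so it
    acts on [ell] as a scalar [phi x], and [phi] is a ring morphism [A -> R],
    positive on the nonzero elements of [F] and zero on [I].  This is the
    constant coefficient of [psi].  The coefficient of [X] has to be a
    [phi]-derivation [D] of [A] which equals [ell] on [I]: then [x [<=] y] iff
    [D x <= D y] when [sim x y].

    Such a [D] exists for the reason that field extensions of characteristic
    zero are formally smooth.  As [A / I] is a product of fields, hence von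
    Neumann regular, [ell] extends from [I] to the kernel of [phi]
    ([ell_extends]) and [phi] has a field as its image.  A subring [L] of [A] that
    is maximal among those on which [ell] vanishes where [phi] does is then,
    by a Hensel-type correction of roots, a complement of the kernel up to
    the kernel of [ell] ([max_lift_ring_surj], as in Cohen's structure theorem),
    and [D (l + p) = ell p] for [l] in [L] ([derivation_extension]).  The
    derivation vanishes on any subring chosen in advance on which [phi] is
    injective; for a semialgebra one takes the scalars, which [phi] embeds as
    themselves since an additive monotone self-map of the half-line that fixes
    [1] is the identity. *)

(** * Calculus with a semiring preorder *)

Section PreorderCalculus.
Variable F : preorderedSemifieldType.
Implicit Types x y z g h : F.

Lemma ple_refl x : x [<=] x.
Proof. by have [r _] := @ple_preorder F; exact: r. Qed.

Lemma ple_trans y x z : x [<=] y -> y [<=] z -> x [<=] z.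
Proof. by have [_ t] := @ple_preorder F; exact: t. Qed.

Lemma pleD x x' y y' : x [<=] x' -> y [<=] y' -> x + y [<=] x' + y'.
Proof.
move=> hx hy; apply: (@ple_trans (x + y')); first exact: pleD2l.
by rewrite ![_ + y']addrC; apply: pleD2l.
Qed.

Lemma pleM x x' y y' : x [<=] x' -> y [<=] y' -> x * y [<=] x' * y'.
Proof.
move=> hx hy; apply: (@ple_trans (x * y')); first exact: pleM2l.
by rewrite ![_ * y']mulrC; apply: pleM2l.
Qed.

Lemma approx_refl x : approx x x.
Proof. by split; exact: ple_refl. Qed.

Lemma approx_sym x y : approx x y -> approx y x.
Proof. by case. Qed.

Lemma approx_trans y x z : approx x y -> approx y z -> approx x z.
Proof. by case=> a b [c d]; split; [apply: ple_trans c|apply: ple_trans b]. Qed.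

#[global] Instance approx_equiv : Equivalence (@approx F).
Proof.
by split; [exact: approx_refl|exact: approx_sym|move=> x y z; exact: approx_trans].
Qed.

#[global] Instance approx_add :
  Proper (@approx F ==> @approx F ==> @approx F) (@GRing.add F).
Proof. by move=> x x' [a b] y y' [c d]; split; exact: pleD. Qed.

#[global] Instance approx_mul :
  Proper (@approx F ==> @approx F ==> @approx F) (@GRing.mul F).
Proof. by move=> x x' [a b] y y' [c d]; split; exact: pleM. Qed.

Lemma approxM2l a x y : approx x y -> approx (a * x) (a * y).
Proof. by case=> *; split; apply: pleM2l. Qed.

#[global] Instance approx_ple :
  Proper (@approx F ==> @approx F ==> iff) (@ple F).
Proof.
move=> x x' [a b] y y' [c d]; split=> h.
  exact: ple_trans b (ple_trans h c).
exact: ple_trans a (ple_trans h d).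
Qed.

Lemma approx_sim x y : approx x y -> sim x y.
Proof. by case=> h _; exact: Relation_Operators.rst_step. Qed.

Lemma ple_sim x y : x [<=] y -> sim x y.
Proof. by move=> h; exact: Relation_Operators.rst_step. Qed.

Lemma semifield_inv x : x <> 0 -> exists y, x * y = 1.
Proof. by move/semifield_unitP. Qed.

Lemma semifield_neq0 x y : x * y = 1 -> x <> 0.
Proof. by move=> h; apply/semifield_unitP; exists y. Qed.

Lemma semifield_oner_neq0 : (1 : F) <> 0.
Proof. by apply: (@semifield_neq0 _ 1); rewrite mulr1. Qed.

Lemma ple_cancelM z x y : z <> 0 -> z * x [<=] z * y -> x [<=] y.
Proof.
move=> /semifield_inv[z' hz] /(pleM2l z' _ _); rewrite !mulrA (mulrC z') hz.
by rewrite !mul1r.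
Qed.

Lemma approx_cancelM z x y : z <> 0 -> approx (z * x) (z * y) -> approx x y.
Proof. by move=> z0 [a b]; split; apply: (ple_cancelM z0). Qed.

End PreorderCalculus.

(** * Hoelder's embedding of an Archimedean ordered group *)

(** [C] is the nonnegative cone of a total preorder on the subgroup [H] of [V];
    a subgroup is used rather than all of [V] because the cone of interest is
    total only on an ideal of a ring.  The unit [w] bounds everything up to
    multiples, and the last field excludes infinitesimals. *)
Record archimedean_cone (V : zmodType) (H C : V -> Prop) (w : V) : Prop :=
  ArchimedeanCone {
    hull_add : forall a b, H a -> H b -> H (a + b);
    hull_opp : forall a, H a -> H (- a);
    cone_hull : forall a, C a -> H a;
    hull_total : forall a, H a -> C a \/ C (- a);
    cone_zero : C 0;
    cone_add : forall a b, C a -> C b -> C (a + b);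
    cone_unit : C w;
    cone_unitN : ~ C (- w);
    cone_bounded : forall a, C a -> exists n, C (w *+ n - a);
    cone_arch : forall a, H a -> (forall n, C (w - a *+ n)) -> C (- a)
  }.

Section Hoelder.
Variables (R : realType) (V : zmodType) (H C : V -> Prop) (w : V).
Hypothesis HC : archimedean_cone H C w.
Implicit Types (a b : V) (p : int) (q n : nat).

(** The lower Dedekind cut of the ratio of [a] to the unit [w]. *)
Definition hoelder_cut a : set R :=
  [set r | exists p q, C (a *+ q.+1 - w *~ p) /\ r = p%:~R / q.+1%:R].

Definition hoelder a : R := sup (hoelder_cut a).

Lemma cone_muln a n : C a -> C (a *+ n).
Proof.
move=> Ca; elim: n => [|n IH]; first by rewrite mulr0n; exact: cone_zero HC.
by rewrite mulrS; apply: (cone_add HC).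
Qed.

Lemma hull_muln a n : H a -> H (a *+ n).
Proof.
move=> Ha; elim: n => [|n IH].
  by rewrite mulr0n; apply/(cone_hull HC)/(cone_zero HC).
by rewrite mulrS; apply: (hull_add HC).
Qed.

Lemma hull_unitz p : H (w *~ p).
Proof.
have Hn n : H (w *+ n) by apply/hull_muln/(cone_hull HC)/(cone_unit HC).
by case: p => n; [exact: Hn|rewrite NegzE mulrNz; apply: (hull_opp HC); exact: Hn].
Qed.

Lemma cone_unitz p : C (w *~ p) -> 0 <= p.
Proof.
case: p => n // Cn; exfalso; apply: (cone_unitN HC).
have := cone_add HC Cn (cone_muln n (cone_unit HC)).
by rewrite NegzE mulrNz -pmulrn mulrS opprD -addrA addNr addr0.
Qed.

Lemma hull_cut_total a p q : H a ->
  C (a *+ q - w *~ p) \/ C (w *~ p - a *+ q).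
Proof.
move=> Ha; rewrite -[w *~ p - _]opprB; apply: (hull_total HC).
by apply: (hull_add HC); [exact: hull_muln|apply/(hull_opp HC)/hull_unitz].
Qed.

Lemma cone_cut_le a p q p' q' :
  C (a *+ q.+1 - w *~ p) -> C (w *~ p' - a *+ q'.+1) ->
  p%:~R / q.+1%:R <= p'%:~R / q'.+1%:R :> R.
Proof.
move=> /(cone_muln q'.+1) h /(cone_muln q.+1) h'.
have := cone_add HC h h'.
rewrite !mulrnBl -!mulrnA (mulnC q'.+1) addrC addrA subrK.
rewrite !pmulrn -!mulrzA -mulrzBr => /cone_unitz; rewrite subr_ge0 => le.
by rewrite ler_pdivrMr ?ltr0Sn // mulrAC ler_pdivlMr ?ltr0Sn // -!intrM ler_int.
Qed.

Lemma hoelder_cut_lower a : H a -> exists p, C (a - w *~ p).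
Proof.
case/(hull_total HC)=> [Ca|/(cone_bounded HC)[n]].
  by exists 0; rewrite mulr0z subr0.
by rewrite opprK => h; exists (- n%:Z); rewrite mulrNz opprK addrC.
Qed.

Lemma hoelder_has_sup a : H a -> has_sup (hoelder_cut a).
Proof.
move=> Ha; split.
  by have [p h] := hoelder_cut_lower Ha; exists (p%:~R / 1%:R), p, 0%N.
have [p h] := hoelder_cut_lower (hull_opp HC Ha).
exists ((- p)%:~R / 1%:R) => _ [p' [q' [h' ->]]].
apply: (cone_cut_le h' (q' := 0)); rewrite mulrNz mulr1n addrC; exact: h.
Qed.

Lemma hoelder_ge a p q :
  H a -> C (a *+ q.+1 - w *~ p) -> p%:~R / q.+1%:R <= hoelder a.
Proof.
move=> Ha h; apply: ub_le_sup; first by case: (hoelder_has_sup Ha).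
by exists p, q.
Qed.

Lemma hoelder_le a p q :
  H a -> C (w *~ p - a *+ q.+1) -> hoelder a <= p%:~R / q.+1%:R.
Proof.
move=> Ha h; apply: sup_le_ub; first by case: (hoelder_has_sup Ha).
by move=> _ [p' [q' [h' ->]]]; apply: cone_cut_le h' h.
Qed.

Lemma hoelder_superadd a b : H a -> H b ->
  hoelder a + hoelder b <= hoelder (a + b).
Proof.
move=> Ha Hb; rewrite leNgt; apply/negP => lt.
set e := hoelder a + hoelder b - hoelder (a + b).
have e0 : 0 < e / 2%:R by rewrite divr_gt0 // subr_gt0.
have [_ [p [q [h ->]]] lt1] := sup_adherent e0 (hoelder_has_sup Ha).
have [_ [p' [q' [h' ->]]] lt2] := sup_adherent e0 (hoelder_has_sup Hb).
have : C ((a + b) *+ (q.+1 * q'.+1).-1.+1 - w *~ (p * q'.+1%:Z + p' * q.+1%:Z)).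
  have := cone_add HC (cone_muln q'.+1 h) (cone_muln q.+1 h').
  rewrite prednK ?muln_gt0 // !mulrnBl -!mulrnA (mulnC q'.+1) mulrnDl mulrzDr opprD.
  by rewrite addrACA !mulrzA -!pmulrn.
move=> /(hoelder_ge (hull_add HC Ha Hb)).
rewrite prednK ?muln_gt0 // natrM intrD !intrM -!pmulrn.
have n0 : q.+1%:R != 0 :> R by rewrite pnatr_eq0.
have n0' : q'.+1%:R != 0 :> R by rewrite pnatr_eq0.
move: lt1 lt2; rewrite -(addf_div _ _ n0 n0') -/(hoelder a) -/(hoelder b).
move: (p%:~R / q.+1%:R) (p'%:~R / q'.+1%:R) => x y; rewrite /e; lra.
Qed.

(** Additivity needs the reverse of [hoelder_superadd]; it is obtained from this
    lemma by writing [a = (a + b) - b].  A rational [s] strictly between would not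
    be in the cut of [- a], nor [- s] in that of [a], contradicting totality. *)
Lemma hoelder_opp_ge a : H a -> - hoelder a <= hoelder (- a).
Proof.
move=> Ha; rewrite leNgt; apply/negP => /rat_in_itvoo[s].
rewrite in_itv /= => /andP[lo hi].
have [q sE] : exists q, s = (numq s)%:~R / q.+1%:R.
  exists `|denq s|.-1; rewrite prednK ?absz_gt0 ?denq_neq0 //.
  rewrite -[LHS]divq_num_den; congr (_ / _).
  by rewrite -[in LHS](gez0_abs (ltW (denq_gt0 s))).
have rs : ratr s = (numq s)%:~R / q.+1%:R :> R.
  by rewrite {1}sE fmorph_div rmorph_int rmorph_nat.
have [h|h] := hull_cut_total (numq s) q.+1 (hull_opp HC Ha).
  by have := hoelder_ge (hull_opp HC Ha) h; rewrite -rs leNgt lo.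
have : C (a *+ q.+1 - w *~ (- numq s)).
  by move: h; rewrite mulNrn opprK mulrNz opprK addrC.
by move=> /(hoelder_ge Ha); rewrite mulrNz mulNr -rs lerNl leNgt hi.
Qed.

Lemma hoelder_unit : hoelder w = 1.
Proof.
have Hw := cone_hull HC (cone_unit HC); have C0 := cone_zero HC.
have c0 : C (w *+ 1 - w *~ 1) by rewrite subrr.
have c1 : C (w *~ 1 - w *+ 1) by rewrite subrr.
apply/eqP; rewrite eq_le.
have := hoelder_ge Hw c0; have := hoelder_le Hw c1.
by rewrite divr1 => -> ->.
Qed.

Lemma hoelder_ge0 a : C a -> 0 <= hoelder a.
Proof.
move=> Ca; have h : C (a *+ 1 - w *~ 0) by rewrite mulr0z subr0.
by have := hoelder_ge (cone_hull HC Ca) h; rewrite mul0r.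
Qed.

Lemma hoelderN a : H a -> hoelder (- a) = - hoelder a.
Proof.
move=> Ha; apply/eqP; rewrite eq_le hoelder_opp_ge // andbT.
have := hoelder_superadd Ha (hull_opp HC Ha); rewrite subrr.
have : hoelder 0 <= 0 / 1.
  apply: (@hoelder_le 0 0 0); first exact/(cone_hull HC)/(cone_zero HC).
  by rewrite mulr0z mul0rn subr0; exact: cone_zero HC.
lra.
Qed.

Lemma hoelderD a b : H a -> H b -> hoelder (a + b) = hoelder a + hoelder b.
Proof.
move=> Ha Hb; apply/eqP; rewrite eq_le hoelder_superadd // andbT.
have := hoelder_superadd (hull_add HC Ha Hb) (hull_opp HC Hb).
by rewrite addrK hoelderN //; lra.
Qed.

Lemma hoelder_le0 a : H a -> hoelder a <= 0 -> C (- a).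
Proof.
move=> Ha le0; apply: (cone_arch HC) => // n.
have [|h] := hull_cut_total 1 n Ha; last exact: h.
case: n => [|n] h.
  by rewrite subr0; exact: cone_unit HC.
have := hoelder_ge Ha h.
have : 0 < 1%:~R / n.+1%:R :> R by rewrite divr_gt0 ?ltr0Sn.
by move: (1%:~R / n.+1%:R) => x; lra.
Qed.

(** A monotone additive map is sandwiched between the same rationals as
    [hoelder], scaled by its value at the unit.  Applied to multiplication by a
    positive ring element, this is where the character [phi] comes from. *)
Lemma hoelder_unique (f : V -> R) a :
  (forall a b, H a -> H b -> f (a + b) = f a + f b) ->
  (forall a, C a -> 0 <= f a) -> H a -> f a = f w * hoelder a.
Proof.
move=> fD f_ge0 Ha; have H0 := cone_hull HC (cone_zero HC).
have f0 : f 0 = 0 by have := fD _ _ H0 H0; rewrite addr0; lra.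
have fN b : H b -> f (- b) = - f b.
  by move=> Hb; have := fD _ _ Hb (hull_opp HC Hb); rewrite subrr f0; lra.
have fMn b n : H b -> f (b *+ n) = f b *+ n.
  move=> Hb; elim: n => [|n IH]; first by rewrite !mulr0n.
  by rewrite !mulrS fD ?IH //; apply: hull_muln.
have fw p : f (w *~ p) = f w * p%:~R.
  have Hw := cone_hull HC (cone_unit HC).
  case: p => n; first by rewrite -!pmulrn fMn // mulr_natr.
  rewrite NegzE !mulrNz fN; last exact: hull_unitz.
  by rewrite -!pmulrn fMn // mulrN mulr_natr.
have key b : H b -> f w * hoelder b <= f b.
  move=> Hb; have fw0 := f_ge0 _ (cone_unit HC).
  have [fwE|fwN0] := eqVneq (f w) 0.
    rewrite fwE mul0r.
    have [|Cb] := hull_total HC Hb; first exact: f_ge0.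
    have [n h] := cone_bounded HC Cb.
    have := f_ge0 _ h; rewrite opprK fD //;
      last exact/hull_muln/(cone_hull HC)/(cone_unit HC).
    by rewrite fMn ?fwE ?mul0rn ?add0r //; exact/(cone_hull HC)/(cone_unit HC).
  have fw1 : 0 < f w by rewrite lt_def fwN0.
  rewrite mulrC -ler_pdivlMr //; apply: sup_le_ub.
    by case: (hoelder_has_sup Hb).
  move=> _ [p [q [h ->]]]; rewrite ler_pdivlMr // mulrAC ler_pdivrMr ?ltr0Sn //.
  have := f_ge0 _ h; rewrite fD; last exact/(hull_opp HC)/hull_unitz.
    rewrite fN; last exact: hull_unitz.
    by rewrite fMn // fw mulr_natr subr_ge0 mulrC.
  exact: hull_muln.
apply/eqP; rewrite eq_le key // andbT.
by have := key _ (hull_opp HC Ha); rewrite fN // hoelderN // mulrN lerN2.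
Qed.

End Hoelder.

(** * Extending a derivation from the kernel of a character *)

Lemma horner_first_order (A : comNzRingType) (p : {poly A}) (t m : A) :
  exists r, p.[t + m] = p.[t] + p^`().[t] * m + r * m * m.
Proof.
elim/poly_ind: p => [|p c [r IH]].
  by exists 0; rewrite deriv0 !horner0; ring.
exists (p^`().[t] + r * (t + m)).
rewrite derivD derivM derivX derivC addr0 mulr1 !hornerE IH; ring.
Qed.

Section Splitting.
Variables (A : comNzRingType) (K : numFieldType) (phi : {rmorphism A -> K}).
Variable ell : A -> K.
Hypothesis ellD :
  forall p q, phi p = 0 -> phi q = 0 -> ell (p + q) = ell p + ell q.
Hypothesis ellM : forall a p, phi p = 0 -> ell (a * p) = phi a * ell p.
Hypothesis phi_inv : forall a, phi a <> 0 -> exists b, phi a * phi b = 1.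
Implicit Types (L S : set A) (a b p q t m x y : A) (f g h : {poly A}).

(** Modulo the ideal of the [p] with [phi p = 0] and [ell p = 0], the kernel of
    [phi] has square zero; a subring is a lift ring if [phi] is injective on it
    modulo that ideal, so that it lifts a subring of the image of [phi]. *)
Record lift_ring L : Prop := LiftRing {
  lift_ring1 : L 1;
  lift_ringB : forall x y, L x -> L y -> L (x - y);
  lift_ringM : forall x y, L x -> L y -> L (x * y);
  lift_ring_ell : forall x, L x -> phi x = 0 -> ell x = 0
}.

Lemma ell0 : ell 0 = 0.
Proof. by rewrite -(mul0r 0) ellM ?rmorph0 ?mul0r. Qed.

Lemma ellN p : phi p = 0 -> ell (- p) = - ell p.
Proof. by move=> p0; rewrite -mulN1r ellM // rmorphN1 mulN1r. Qed.

Section LiftRingTheory.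
Variable L : set A.
Hypothesis LL : lift_ring L.

Lemma lift_ring0 : L 0.
Proof. by rewrite -(subrr 1); apply: lift_ringB => //; exact: lift_ring1. Qed.

Lemma lift_ringN x : L x -> L (- x).
Proof. by move=> Lx; rewrite -sub0r; apply: lift_ringB => //; exact: lift_ring0. Qed.

Lemma lift_ringD x y : L x -> L y -> L (x + y).
Proof.
by move=> Lx Ly; rewrite -[y]opprK; apply: lift_ringB => //; exact: lift_ringN.
Qed.

Lemma lift_ringMn x n : L x -> L (x *+ n).
Proof.
move=> Lx; elim: n => [|n IH]; first exact: lift_ring0.
by rewrite mulrS; apply: lift_ringD.
Qed.

Definition poly_over_set h := forall i, L h`_i.

Lemma poly_over_setC c : L c -> poly_over_set c%:P.
Proof. by move=> Lc i; rewrite coefC; case: ifP => // _; exact: lift_ring0. Qed.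

Lemma poly_over_setX : poly_over_set 'X.
Proof.
move=> i; rewrite coefX; case: eqP => _; first exact: lift_ring1.
exact: lift_ring0.
Qed.

Lemma poly_over_setB f g :
  poly_over_set f -> poly_over_set g -> poly_over_set (f - g).
Proof. by move=> Lf Lg i; rewrite coefB; apply: lift_ringB. Qed.

Lemma poly_over_setM f g :
  poly_over_set f -> poly_over_set g -> poly_over_set (f * g).
Proof.
move=> Lf Lg i; rewrite coefM; apply: (big_ind L).
- exact: lift_ring0.
- by move=> *; apply: lift_ringD.
- by move=> j _; apply: lift_ringM.
Qed.

Lemma poly_over_setXn n : poly_over_set 'X^n.
Proof.
elim: n => [|n IH].
  by rewrite expr0 -polyC1; apply: poly_over_setC; exact: lift_ring1.
by rewrite exprS; apply: poly_over_setM => //; exact: poly_over_setX.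
Qed.

Lemma poly_over_set_deriv f : poly_over_set f -> poly_over_set f^`().
Proof. by move=> Lf i; rewrite coef_deriv; apply: lift_ringMn. Qed.

Lemma poly_over_set_lead f : poly_over_set f -> L (lead_coef f).
Proof. by move=> Lf; exact: Lf. Qed.

Lemma lift_ring_adjoin t :
    (forall h, poly_over_set h -> phi h.[t] = 0 -> ell h.[t] = 0) ->
  lift_ring [set a | exists2 h, poly_over_set h & a = h.[t]].
Proof.
move=> triv; split.
- by exists 1%:P; rewrite ?hornerC //; apply: poly_over_setC; exact: lift_ring1.
- move=> _ _ [f Lf ->] [g Lg ->]; exists (f - g); last by rewrite !hornerE.
  exact: poly_over_setB.
- move=> _ _ [f Lf ->] [g Lg ->]; exists (f * g); last by rewrite !hornerE.
  exact: poly_over_setM.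
- by move=> _ [f Lf ->]; exact: triv.
Qed.

(** Pseudo-division without units.  A polynomial [h] that vanishes at [t] under
    [phi] is lowered in degree, either by dropping a leading coefficient in
    the kernel, or by subtracting a multiple of some [g] of no larger degree at
    whose value both [phi] and [ell] vanish. *)
Lemma ell_root_descent t :
  (forall h, poly_over_set h -> phi h.[t] = 0 -> phi (lead_coef h) <> 0 ->
    exists g, [/\ poly_over_set g, phi (lead_coef g) <> 0,
      (size g <= size h)%N, phi g.[t] = 0 & ell g.[t] = 0]) ->
  forall h, poly_over_set h -> phi h.[t] = 0 -> ell h.[t] = 0.
Proof.
move=> red h; have [n] := ubnP (size h); elim: n h => // n IH h.
rewrite ltnS leq_eqVlt => /orP[/eqP sh|]; last by move=> lt; apply: IH.
move=> Lh h0; case: n => [|n] in sh IH *.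
  by move/eqP: sh; rewrite size_poly_eq0 => /eqP->; rewrite horner0 ell0.
have lcE : lead_coef h = h`_n by rewrite lead_coefE sh.
have [lc0|lcN0] := pselect (phi (lead_coef h) = 0).
  pose h' := h - (lead_coef h)%:P * 'X^n.
  have hE : h.[t] = h'.[t] + t ^+ n * lead_coef h.
    by rewrite /h' !hornerE; ring.
  have e0 : phi (t ^+ n * lead_coef h) = 0 by rewrite rmorphM lc0 mulr0.
  have h'0 : phi h'.[t] = 0 by move: h0; rewrite hE rmorphD e0 addr0.
  have Llc := poly_over_set_lead Lh.
  rewrite hE ellD // (ellM _ lc0) (lift_ring_ell LL Llc lc0) mulr0 addr0.
  apply: IH => //; last first.
    apply: poly_over_setB => //; apply: poly_over_setM; last exact: poly_over_setXn.
    exact: poly_over_setC.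
  rewrite ltnS; apply/leq_sizeP => i; rewrite coefB coefCM coefXn leq_eqVlt.
  move=> /orP[/eqP <-|lt]; first by rewrite eqxx mulr1 lcE subrr.
  by rewrite gtn_eqF // mulr0 subr0 nth_default // sh.
have [g [Lg lgN0 sg g0 eg0]] := red h Lh h0 lcN0.
have gN0 : g != 0 by apply/eqP => gE; apply: lgN0; rewrite gE lead_coef0 rmorph0.
have [k sgE] : exists k, size g = k.+1.
  by exists (size g).-1; rewrite prednK // size_poly_gt0.
have kn : (k <= n)%N by rewrite -ltnS -sgE -sh.
pose h' := (lead_coef g)%:P * h - (lead_coef h)%:P * 'X^(n - k) * g.
have Lh' : poly_over_set h'.
  apply: poly_over_setB; last apply: poly_over_setM => //; last first.
  - apply: poly_over_setM; last exact: poly_over_setXn.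
    by apply: poly_over_setC; exact: poly_over_set_lead.
  - apply: poly_over_setM => //.
    by apply: poly_over_setC; exact: poly_over_set_lead.
have hE : lead_coef g * h.[t] = h'.[t] + lead_coef h * t ^+ (n - k) * g.[t].
  by rewrite /h' !hornerE; ring.
have h'0 : phi h'.[t] = 0.
  move/(congr1 phi): hE; rewrite !(rmorphM, rmorphD) /= h0 g0 !mulr0 addr0.
  by move=> <-.
have e0 : phi (lead_coef h * t ^+ (n - k) * g.[t]) = 0.
  by rewrite rmorphM g0 mulr0.
move/(congr1 ell): hE; rewrite (ellM _ h0) (ellD h'0 e0) (ellM _ g0) eg0 mulr0.
rewrite addr0 (IH h') //.
  by move/eqP; rewrite mulf_eq0 => /orP[/eqP//|/eqP].
rewrite ltnS; apply/leq_sizeP => i; rewrite coefB coefCM -mulrA coefCM coefXnM.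
rewrite leq_eqVlt => /orP[/eqP <-|lt].
  rewrite ltnNge leq_subr /= subKn // -lcE.
  by rewrite [in X in _ - X]mulrC lead_coefE sgE subrr.
rewrite nth_default ?sh // mulr0 ltnNge (leq_trans (leq_subr _ _) (ltnW lt)) /=.
by rewrite nth_default ?mulr0 ?subr0 // sgE; lia.
Qed.

End LiftRingTheory.

Definition max_lift_ring L :=
  lift_ring L /\ forall L', lift_ring L' -> (L `<=` L')%classic -> L' = L.

Lemma max_lift_ring_exists S :
  lift_ring S -> exists2 L, max_lift_ring L & (S `<=` L)%classic.
Proof.
move=> LS.
(* The union with [S] makes the empty chain have an upper bound. *)
pose P (L : set A) := lift_ring (L `|` S)%classic.
have [|L [PL maxL]] := @Zorn_bigcup A P.
  move=> G GP Gtot; rewrite /P /=.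
  set U := (\bigcup_(X in G) X `|` S)%classic.
  have common x y : U x -> U y ->
      exists Z, [/\ lift_ring Z, (Z `<=` U)%classic, Z x & Z y].
    have GZ X : G X -> (X `|` S `<=` U)%classic.
      by move=> GX z [Xz|Sz]; [left; exists X|right].
    move=> [[X GX Xx]|Sx] [[Y GY Yy]|Sy].
    - have [XY|YX] := Gtot _ _ GX GY.
        exists (Y `|` S)%classic; split; [exact: GP|exact: GZ|left; exact: XY|by left].
      exists (X `|` S)%classic; split; [exact: GP|exact: GZ|by left|left; exact: YX].
    - by exists (X `|` S)%classic; split; [exact: GP|exact: GZ|left|right].
    - by exists (Y `|` S)%classic; split; [exact: GP|exact: GZ|right|left].
    - by exists S; split => // z Sz; right.
  split.
  - by right; exact: lift_ring1.
  - move=> x y Ux Uy; have [Z [LZ ZU Zx Zy]] := common _ _ Ux Uy.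
    by apply: ZU; apply: lift_ringB.
  - move=> x y Ux Uy; have [Z [LZ ZU Zx Zy]] := common _ _ Ux Uy.
    by apply: ZU; apply: lift_ringM.
  - move=> x Ux; have [Z [LZ ZU Zx _]] := common _ _ Ux Ux.
    exact: lift_ring_ell Zx.
exists (L `|` S)%classic; last by move=> x Sx; right.
split=> // L' LL' sub; apply: contrapT => neq; apply: (maxL L').
  split=> [x Lx|sub']; first by apply: sub; left.
  by apply: neq; apply/seteqP; split=> // x /sub' Lx; left.
rewrite /P /=; suff -> : (L' `|` S)%classic = L' by [].
by apply/seteqP; split=> [x [//|Sx]|x]; [apply: sub; right|left].
Qed.

Lemma max_lift_ring_adjoin L t : max_lift_ring L ->
  (forall h, poly_over_set L h -> phi h.[t] = 0 -> ell h.[t] = 0) -> L t.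
Proof.
move=> [LL maxL] triv; have LL' := lift_ring_adjoin LL triv.
rewrite -(maxL _ LL'); first by exists 'X; rewrite ?hornerX //; exact: poly_over_setX.
by move=> x Lx; exists x%:P; rewrite ?hornerC //; exact: poly_over_setC.
Qed.

(** Adjoining a suitable translate [t + m] to [L] gives a lift ring again, so
    [t + m] is in [L] by maximality.  If [phi t] is transcendental, [m = 0] will do.
    If it is algebraic, a polynomial [g] of minimal degree has a simple root at
    [phi t] because the characteristic is zero, and one Newton step
    moves [t] to a root of [g] modulo the kernel of [ell], which contains the
    squares of the kernel of [phi]. *)
Lemma max_lift_ring_surj L t : max_lift_ring L ->
  exists2 m, phi m = 0 & L (t + m).
Proof.
move=> maxL; have [LL _] := maxL.
pose cand n := exists f, [/\ poly_over_set L f, phi (lead_coef f) <> 0,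
  size f = n & phi f.[t] = 0].
have [[n0 cand0]|nocand] := pselect (exists n, cand n); last first.
  exists 0; rewrite ?rmorph0 // addr0; apply: max_lift_ring_adjoin => //.
  apply: ell_root_descent => // h Lh h0 lc0.
  by case: nocand; exists (size h), h.
have ex : exists n, `[< cand n >] by exists n0; apply/asboolP.
case: (ex_minnP ex) => n /asboolP[g [Lg lgN0 sg g0]] minn.
(* Degree at least one: a constant that [phi] does not kill has no root. *)
case: n => [|[|k]] in sg minn.
- by case: lgN0; move/eqP: sg; rewrite size_poly_eq0 => /eqP->; rewrite lead_coef0 rmorph0.
- case: lgN0; have gE := size1_polyC (eq_leq sg).
  by move: g0; rewrite gE hornerC lead_coefC.
have coefk : phi g^`()`_k <> 0.
  rewrite coef_deriv rmorphMn -[g`_k.+1]/(g`_(k.+2.-1)) -sg -lead_coefE.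
  by apply/eqP; rewrite mulrn_eq0 negb_or /=; apply/eqP.
have sg' : size g^`() = k.+1.
  apply/eqP; rewrite eqn_leq; apply/andP; split.
    by rewrite -ltnS -sg lt_size_deriv // -size_poly_eq0 sg.
  rewrite ltnNge; apply/negP => le; apply: coefk.
  by rewrite nth_default // rmorph0.
have g'N0 : phi g^`().[t] <> 0.
  move=> g'0; suff /minn : `[< cand k.+1 >] by rewrite ltnn.
  apply/asboolP; exists g^`(); split=> //; first exact: poly_over_set_deriv.
  by rewrite lead_coefE sg'.
have [b hb] := phi_inv g'N0.
(* The Newton step, [b] being an inverse of [g'(t)] under [phi]. *)
pose m := - (b * g.[t]); have m0 : phi m = 0 by rewrite rmorphN rmorphM g0 mulr0 oppr0.
have phim h : phi h.[t + m] = phi h.[t].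
  by rewrite -!horner_map /= rmorphD m0 addr0.
exists m => //; apply: max_lift_ring_adjoin => //.
apply: ell_root_descent => // h Lh h0 lcN0.
exists g; split=> //; last first.
- have [r ->] := horner_first_order g t m.
  have -> : g.[t] + g^`().[t] * m + r * m * m =
      (1 - g^`().[t] * b) * g.[t] + (r * m) * m by rewrite /m; ring.
  rewrite ellD; [|by rewrite rmorphM g0 mulr0|by rewrite rmorphM m0 mulr0].
  by rewrite !ellM // !(rmorphB, rmorphM, rmorph1) /= hb subrr m0 mulr0 !mul0r addr0.
- by rewrite phim.
- by rewrite sg; apply: minn; apply/asboolP; exists h; rewrite -phim.
Qed.

(** With [L] a maximal lift ring, [a = l + p] with [l] in [L] and [phi p = 0], and
    [ell p] does not depend on the decomposition; products of two elements of
    the kernel are killed by [ell], so this is a derivation. *)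
Lemma derivation_extension S : lift_ring S ->
  exists D : A -> K, [/\ forall a b, D (a + b) = D a + D b,
    forall a b, D (a * b) = phi a * D b + phi b * D a,
    forall p, phi p = 0 -> D p = ell p & forall a, S a -> D a = 0].
Proof.
move=> /max_lift_ring_exists[L maxL SL]; have [LL _] := maxL.
have /choice[m mP] a : exists m, phi m = 0 /\ L (a + m).
  by have [m] := max_lift_ring_surj a maxL; exists m.
pose D a := - ell (m a).
have DE a p : phi p = 0 -> L (a - p) -> D a = ell p.
  move=> p0 Lp; have [ma0 Lma] := mP a; apply/eqP; rewrite /D eq_sym -addr_eq0.
  rewrite -ellD //; apply/eqP; apply: (lift_ring_ell LL); last first.
    by rewrite rmorphD p0 ma0 addr0.
  have -> : p + m a = (a + m a) - (a - p) by ring.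
  exact: lift_ringB.
have mB a : L (a - - m a) by rewrite opprK; case: (mP a).
have mN a : phi (- m a) = 0 by rewrite rmorphN; case: (mP a) => ->; rewrite oppr0.
have DmE a : D a = ell (- m a) by exact: DE.
exists D; split.
- move=> a b; rewrite [D a]DmE [D b]DmE -ellD //; apply: DE.
    by rewrite rmorphD !mN addr0.
  have -> : a + b - (- m a - m b) = (a - - m a) + (b - - m b) by ring.
  exact: lift_ringD.
- move=> a b; rewrite [D a]DmE [D b]DmE -!ellM // -ellD ?rmorphM ?mN ?mulr0 //.
  set x := - m a; set y := - m b.
  have xy0 : phi (x * y) = 0 by rewrite rmorphM mN mul0r.
  have s0 : phi (a * y + b * x) = 0 by rewrite rmorphD !rmorphM !mN !mulr0 addr0.
  have xy1 : phi (- (x * y)) = 0 by rewrite rmorphN xy0 oppr0.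
  rewrite (DE _ (a * y + b * x - x * y)).
  - by rewrite (ellD s0 xy1) ellN // ellM ?mN // mul0r oppr0 addr0.
  - by rewrite rmorphD s0 xy1 addr0.
  have -> : a * b - (a * y + b * x - x * y) = (a - x) * (b - y) by ring.
  exact: lift_ringM.
- by move=> p p0; apply: DE => //; rewrite subrr; exact: lift_ring0.
- move=> a Sa; rewrite -ell0; apply: DE; first exact: rmorph0.
  by rewrite subr0; exact: SL.
Qed.

End Splitting.

(** * Grothendieck rings, regularity, dual numbers *)

Section GrothendieckEmbedding.
Variable T : comPzSemiRingType.
Implicit Types x y z : T.

Definition gr x : groth T := \pi_(groth T) (x, 0).

Lemma gr_pairE x y : \pi_(groth T) (x, y) = gr x - gr y.
Proof.
transitivity (gr_add (gr x) (gr_opp (gr y))); last by [].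
rewrite gr_oppE gr_addE; congr (\pi_(groth T) _).
by rewrite /pr_add /= addr0 add0r.
Qed.

Lemma grD x y : gr (x + y) = gr x + gr y.
Proof.
transitivity (gr_add (gr x) (gr y)); last by [].
by rewrite gr_addE /pr_add /= addr0.
Qed.

Lemma grM x y : gr (x * y) = gr x * gr y.
Proof.
transitivity (gr_mul (gr x) (gr y)); last by [].
by rewrite gr_mulE /pr_mul /= !mulr0 mul0r !addr0.
Qed.

Lemma gr1 : gr 1 = 1. Proof. by []. Qed.
Lemma gr0 : gr 0 = 0. Proof. by []. Qed.

Lemma gr_nat n : gr n%:R = n%:R.
Proof. by elim: n => [|n IH]; rewrite ?gr0 // -!natr1 grD IH. Qed.

Lemma groth_subP (a : groth T) : exists x y, a = gr x - gr y.
Proof. by elim/quotW: a => -[x y]; exists x, y; exact: gr_pairE. Qed.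

Lemma gr_sub_eq x y x' y' : gr x - gr y = gr x' - gr y' <->
  exists k, x + y' + k = x' + y + k.
Proof. by rewrite -!gr_pairE; exact: gr_piP. Qed.

End GrothendieckEmbedding.

Lemma product_of_fields_regular (B : comPzRingType) (a : B) :
  finite_product_of_fields B -> exists b, a * a * b = a.
Proof.
move=> [n [K [p pbij]]]; have [g pK gK] := pbij.
exists (g (fun i => (p i a)^-1)); apply: (bij_inj pbij).
apply: functional_extensionality_dep => i.
rewrite !rmorphM.
have -> : p i (g (fun i => (p i a)^-1)) = (p i a)^-1.
  by have := congr1 (fun h => h i) (gK (fun i => (p i a)^-1)).
by have [->|nz] := eqVneq (p i a) 0; rewrite ?mul0r // mulfK.
Qed.

(** Additive and nonnegative implies monotone; comparing the multiple [r *+ n]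
    with its integer part shows that [n] times the difference of [f r] and [r]
    stays bounded by [1]. *)
Lemma nnreal_additive_id (R : realType) (f : nnreal R -> R) :
  (forall r s, f (r + s) = f r + f s) -> (forall r, 0 <= f r) -> f 1 = 1 ->
  forall r, f r = val r.
Proof.
move=> fD f0 f1.
have le r s : val r <= val s -> f r <= f s.
  move=> rs; have sr0 : val s - val r \is Num.nneg by rewrite nnegrE subr_ge0.
  have -> : s = r + Sub (val s - val r) sr0.
    by apply: val_inj; rewrite rmorphD /= addrCA subrr addr0.
  by rewrite fD lerDl.
have f00 : f 0 = 0 by have := fD 0 0; rewrite addr0; lra.
have fn n : f n%:R = n%:R.
  by elim: n => [|n IH] //; rewrite -!natr1 fD IH f1.
have fMn r n : f (r *+ n) = f r *+ n.
  by elim: n => [|n IH] //; rewrite !mulrS fD IH.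
have close r n : `|(f r - val r) *+ n| <= 1.
  have vn : val (r *+ n) = val r *+ n by rewrite rmorphMn.
  have vk k : val (k%:R : nnreal R) = k%:R by rewrite rmorph_nat.
  have v0 : 0 <= val (r *+ n) by exact: (valP (r *+ n)).
  have /andP[lo hi] := truncn_itv v0.
  set k := Num.truncn _ in lo hi.
  have := le k%:R (r *+ n); rewrite vk => /(_ lo); rewrite fn.
  have := le (r *+ n) k.+1%:R; rewrite vk => /(_ (ltW hi)); rewrite fn fMn.
  rewrite mulrnBl -vn -natr1 ler_norml; move: lo hi; rewrite -natr1.
  by move: (f r *+ n) (val (r *+ n)) (k%:R) => x y z ? ? ? ?; apply/andP; split; lra.
move=> r; apply/eqP; rewrite -subr_eq0 -normr_eq0; apply/negPn/negP => nz.
have d0 : 0 < `|f r - val r| by rewrite lt_def nz normr_ge0.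
have := archi_boundP (ltW (divr_gt0 ltr01 d0)).
set n := Num.bound _; rewrite ltr_pdivrMr // => lt.
have := close r n; rewrite normrMn -mulr_natl leNgt lt; by [].
Qed.

Section DualNumbers.
Variable R : realType.

Definition mkdual (r s : R) : dualnum R := in_qpoly 'X^2 (r%:P + s *: 'X).

Lemma mkdual_coef r s : (mkdual r s)`_0 = r /\ (mkdual r s)`_1 = s.
Proof.
have st : (size (r%:P + s *: 'X)%R < size (mk_monic ('X^2 : {poly R})))%N.
  rewrite mk_monic_Xn size_polyXn ltnS (leq_trans (size_polyD _ _)) //.
  rewrite geq_max (leq_trans (size_polyC_leq1 _)) //=.
  by rewrite (leq_trans (size_scale_leq _ _)) ?size_polyX.
rewrite /mkdual in_qpoly_small // !coefD !coefC !coefZ !coefX /=.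
by rewrite mulr0 mulr1 addr0 add0r.
Qed.

Definition mkdual0 r s := (mkdual_coef r s).1.
Definition mkdual1 r s := (mkdual_coef r s).2.

End DualNumbers.

Lemma linpoly_hom_exists (R : realType) (F : comPzSemiRingType) (f d : F -> R) :
  (forall x, x <> 0 -> 0 < f x) ->
  (forall x y, f (x + y) = f x + f y) -> (forall x y, f (x * y) = f x * f y) ->
  f 1 = 1 ->
  (forall x y, d (x + y) = d x + d y) ->
  (forall x y, d (x * y) = f x * d y + f y * d x) ->
  exists psi : {rmorphism F -> linpoly R},
    forall x, (val (psi x))`_0 = f x /\ (val (psi x))`_1 = d x.
Proof.
move=> f_gt0 fD fM f1 dD dM.
have f0 : f 0 = 0 by have := fD 0 0; rewrite addr0; lra.
have d0 : d 0 = 0 by have := dD 0 0; rewrite addr0; lra.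
have d1 : d 1 = 0 by have := dM 1 1; rewrite mulr1 f1; lra.
have predP x : linpoly_pred (mkdual (f x) (d x)).
  have [->|x0] := pselect (x = 0).
    apply/orP; right; apply/eqP; apply: dualP;
    by rewrite ?mkdual0 ?mkdual1 ?f0 ?d0 dual0.
  by apply/orP; left; rewrite mkdual0; exact: f_gt0.
pose psi0 x : linpoly R := Sub (mkdual (f x) (d x)) (predP x).
have psiE x : val (psi0 x) = mkdual (f x) (d x) by rewrite SubK.
have h0 : nmod_morphism psi0.
  split=> [|x y]; apply: val_inj; rewrite ?rmorphD ?rmorph0 !psiE; apply: dualP;
    by rewrite ?dualD ?mkdual0 ?mkdual1 ?dual0.
have h1 : monoid_morphism psi0.
  split=> [|x y]; apply: val_inj; rewrite ?rmorphM ?rmorph1 !psiE; apply: dualP;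
    rewrite ?dualM0 ?dualM1 ?mkdual0 ?mkdual1 ?dual1 ?fM ?dM //.
  by rewrite [d x * _]mulrC.
pose m1 := GRing.isNmodMorphism.Build F (linpoly R) psi0 h0.
pose m2 := GRing.isMonoidMorphism.Build F (linpoly R) psi0 h1.
pose psi : {rmorphism F -> linpoly R} := HB.pack psi0 m1 m2.
by exists psi => x; rewrite -[psi x]/(psi0 x) psiE mkdual0 mkdual1.
Qed.

(** * First-order arithmetic of an arctic preordered semifield *)

Section Representation.
Variables (R : realType) (F : preorderedSemifieldType) (u : F).
Hypotheses (F_arch : mult_archimedean F) (F_full : fully_preordered F)
  (u_univ : power_universal u) (u_gt1 : 1 [<] u) (F_arctic : arctic F)
  (F_qcompl : quasi_complements (sim_quot F)).
Implicit Types (x y z g h k : F).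

Let u_neq0 : u <> 0. Proof. by case: u_univ. Qed.

(** Otherwise [-1] is in [F], and adding its multiple of [1 [<=] u] reverses the
    inequality. *)
Lemma semifield_addr_eq0 x y : x + y = 0 -> x = 0.
Proof.
move=> xy0; apply: contrapT => x0; have [x' xx'] := semifield_inv x0.
have w1 : 1 + y * x' = 0 by rewrite -xx' -mulrDl xy0 mul0r.
have [u1 nu1] := u_gt1; apply: nu1.
have /(pleD2l (1 + u)) := pleM2l (y * x') _ _ u1.
have -> : 1 + u + y * x' * 1 = u + (1 + y * x') by ring.
have -> : 1 + u + y * x' * u = 1 + (1 + y * x') * u by ring.
by rewrite w1 mul0r !addr0.
Qed.

Lemma semifield_natS_neq0 n : (n.+1%:R : F) <> 0.
Proof.
rewrite -natr1 addrC => /semifield_addr_eq0; exact: semifield_oner_neq0.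
Qed.

(** Fullness extends the arctic identity from [x > 1] to the class of [1], since
    it is symmetric in [x] and its inverse. *)
Lemma arctic_sim x x' : x * x' = 1 -> sim x 1 -> approx (x + x') 2%:R.
Proof.
move=> xx' x1.
have key y y' : y * y' = 1 -> 1 [<=] y -> approx (y + y') 2%:R.
  move=> yy' y1; have [y_le1|] := pselect (y [<=] 1); last first.
    by move=> ny; apply: F_arctic.
  have hy : approx y 1 by [].
  have hy' : approx y' 1.
    by rewrite -yy' -{1}(mul1r y') hy; apply: approx_refl.
  rewrite hy hy'; exact: approx_refl.
have [/(pleM2l x')|] := F_full x1; last exact: key.
by rewrite mulrC xx' mulr1 addrC; apply: key; rewrite mulrC.
Qed.

(** If [1] and [0] are related, so is everything, and the arctic identity holds
    throughout.  At [x = 2] it reads [1 + 1/4 ~ 1], hence [2 ~ 1]; at [x = u] it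
    then reads [u + u^-1 ~ 1], which is impossible when [0] is comparable with
    [1], hence an upper or a lower bound of everything. *)
Lemma not_sim10 : ~ sim (1 : F) 0.
Proof.
move=> s10.
have allsim x : sim x 1.
  by rewrite -[x]mulr1; apply: (@sim_trans _ 0); [rewrite -(mulr0 x); apply: simM;
    [apply: sim_refl|] |apply: sim_sym].
have [h hh] := semifield_inv (@semifield_natS_neq0 1).
have e1 : approx (1 + h * h) 1.
  have /(approxM2l h) := arctic_sim hh (allsim _).
  by rewrite mulrDr (mulrC h 2%:R) hh.
have en n : approx (1 + n%:R * (h * h)) 1.
  elim: n => [|n IH]; first by rewrite mul0r addr0; apply: approx_refl.
  rewrite -natr1 mulrDl mul1r addrA IH; exact: e1.
have e2 : approx (2%:R : F) 1.
  have := en 4.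
  have -> : 1 + 4%:R * (h * h) = 1 + (2%:R * h) * (2%:R * h) :> F by ring.
  by rewrite hh mul1r.
have [u1 nu1] := u_gt1; apply: nu1.
have [u' uu'] := semifield_inv u_neq0.
have eu : approx (u + u') 1.
  by rewrite (arctic_sim uu' (allsim _)) e2; apply: approx_refl.
have pos x : (0 : F) [<=] 1 -> 0 [<=] x.
  by move=> /(pleM2l x _ _); rewrite mulr0 mulr1.
have neg x : (1 : F) [<=] 0 -> x [<=] 0.
  by move=> /(pleM2l x _ _); rewrite mulr0 mulr1.
have [le10|le01] := F_full s10; last first.
  apply: ple_trans (proj1 eu); rewrite -{1}[u]addr0.
  by apply: pleD2l; apply: pos.
have : 1 [<=] u'.
  by apply: ple_trans (proj2 eu) _; rewrite -{2}[u']add0r; apply: pleD;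
    [apply: neg|apply: ple_refl].
by move=> /(pleM2l u _ _); rewrite mulr1 uu'.
Qed.

Lemma sim0 x : sim x 0 -> x = 0.
Proof.
move=> x0; apply: contrapT => /semifield_inv[x' xx']; apply: not_sim10.
by rewrite -xx' -(mul0r x'); apply: simM => //; apply: sim_refl.
Qed.

Lemma sim_neq0 x y : sim x y -> y <> 0 -> x <> 0.
Proof. by move=> + y0 x0; rewrite x0 => /sim_sym/sim0. Qed.

(** A totally preordered group has no torsion. *)
Lemma approx_sqrr g h : g <> 0 -> sim g h -> approx (g * g) (h * h) -> approx g h.
Proof.
move=> g0 gh e; have h0 : h <> 0 by apply: sim_neq0 g0; apply: sim_sym.
have key x y : x <> 0 -> y <> 0 -> approx (x * x) (y * y) -> x [<=] y -> approx x y.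
  move=> x0 y0 exy xy; split=> //; apply: (ple_cancelM y0).
  apply: (@ple_trans _ (x * x)); first by case: exy.
  by rewrite (mulrC y); apply: pleM2l.
have [] := F_full gh; first exact: key.
by move=> /key - /(_ h0 g0 (approx_sym e)) /approx_sym.
Qed.

Lemma arctic_sqrD1 g : sim g 1 -> approx ((1 + g) * (1 + g)) (4%:R * g).
Proof.
move=> g1; have g0 := sim_neq0 g1 (@semifield_oner_neq0 F).
have [g' gg'] := semifield_inv g0.
have -> : (1 + g) * (1 + g) = g * g' + g * (g + 2%:R) by rewrite gg'; ring.
have -> : g * g' + g * (g + 2%:R) = g * ((g + g') + 2%:R) by ring.
rewrite (arctic_sim gg' g1).
have -> : g * (2%:R + 2%:R) = 4%:R * g by ring.
exact: approx_refl.
Qed.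

(** Both sides have square [4 g h] by [arctic_sqrD1], the right one after
    factoring out [g]. *)
Lemma arctic_mulD1 g h : sim g 1 -> sim h 1 -> approx (g * h + 1) (g + h).
Proof.
move=> g1 h1; have g0 := sim_neq0 g1 (@semifield_oner_neq0 F).
have [g' gg'] := semifield_inv g0.
have gh1 : sim (g * h) 1 by rewrite -[in sim _ 1](mulr1 1); apply: simM.
have g'1 : sim g' 1.
  by apply: sim_sym; have := simM g1 (sim_refl g'); rewrite gg' mul1r.
have hg1 : sim (h * g') 1 by rewrite -[in sim _ 1](mulr1 1); apply: simM.
apply: approx_sqrr.
- rewrite addrC => /semifield_addr_eq0; exact: semifield_oner_neq0.
- apply: (@sim_trans _ (1 + 1)); first by apply: simD => //; apply: sim_refl.
  by apply: sim_sym; apply: simD.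
rewrite (addrC _ 1) (arctic_sqrD1 gh1).
have -> : (g + h) * (g + h) = g * g * ((1 + h * g') * (1 + h * g')).
  have -> : g + h = g * 1 + h * (g * g') by rewrite gg' !mulr1.
  by ring.
rewrite (arctic_sqrD1 hg1).
have -> : g * g * (4%:R * (h * g')) = 4%:R * (g * h) * (g * g') by ring.
rewrite gg' mulr1; exact: approx_refl.
Qed.

Lemma simX1 g n : sim g 1 -> sim (g ^+ n) 1.
Proof.
move=> g1; elim: n => [|n IH]; first by rewrite expr0; apply: sim_refl.
by rewrite exprS -[in sim _ 1](mulr1 1); apply: simM.
Qed.

(** Bernoulli's inequality is an equality here: iterate [arctic_mulD1]. *)
Lemma arctic_bernoulli g n : sim g 1 -> approx (g ^+ n.+1 + n%:R) (n.+1%:R * g).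
Proof.
move=> g1; elim: n => [|n IH].
  by rewrite addr0 expr1 mul1r; apply: approx_refl.
rewrite exprS -natr1.
have -> : g * g ^+ n.+1 + (n%:R + 1) = (g * g ^+ n.+1 + 1) + n%:R by ring.
rewrite (arctic_mulD1 g1 (simX1 _ g1)) -addrA IH.
have -> : g + n.+1%:R * g = n.+2%:R * g by rewrite -(natr1 n.+1); ring.
exact: approx_refl.
Qed.

Lemma quasi_complement x : exists y n, sim (x + y) n.+1%:R.
Proof.
have [y' [n]] := F_qcompl (\pi_(sim_quot F) x).
elim/quotW: y' => y; rewrite -sim_piD => e.
exists (y + 1), n; rewrite addrA -natr1; apply: simD; last exact: sim_refl.
apply/sim_piP; rewrite e.
elim: n {e} => [|n IH]; first by [].
by rewrite -!natr1 sim_piD -IH.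
Qed.

(** If [x + y = n v] with [v] in the class of [1], adding [n v^-1] turns this sum
    into [2 n] by the arctic identity. *)
Lemma quasi_complement_approx x : exists c n, approx (x + c) n.+1%:R.
Proof.
have [y [n s]] := quasi_complement x.
have n0 := @semifield_natS_neq0 n; have [n' nn'] := semifield_inv n0.
set v := (x + y) * n'.
have v1 : sim v 1.
  by rewrite /v -[in sim _ 1]nn'; apply: simM => //; apply: sim_refl.
have v0 := sim_neq0 v1 (@semifield_oner_neq0 F).
have [v' vv'] := semifield_inv v0.
exists (y + n.+1%:R * v'), (n.+1 + n)%N.
have -> : x + (y + n.+1%:R * v') = n.+1%:R * (v + v').
  have -> : x + (y + n.+1%:R * v') = (n.+1%:R * n') * (x + y) + n.+1%:R * v'.
    by rewrite nn'; ring.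
  by rewrite /v; ring.
rewrite (arctic_sim vv' v1) -addnS natrD.
have -> : n.+1%:R * 2%:R = n.+1%:R + n.+1%:R :> F by ring.
exact: approx_refl.
Qed.

(** The hypothesis propagates to [g ^ j + 1 + k ~ 2 + k] for every [j].
    Completing [1 + k] to a natural number [n + 1] and taking [j = n + 2],
    [arctic_bernoulli] rewrites the left side as [(n + 2) g]. *)
Lemma approx_cancelD1 g k : sim g 1 -> approx (g + k) (1 + k) -> approx g 1.
Proof.
move=> g1 e.
have step j : approx (g ^+ j + 1 + k) (2%:R + k).
  elim: j => [|j IH]; first by rewrite expr0; apply: approx_refl.
  rewrite exprS (arctic_mulD1 g1 (simX1 _ g1)).
  have -> : g + g ^+ j + k = g ^+ j + (g + k) by ring.
  by rewrite e addrA.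
have [c [n ec]] := quasi_complement_approx (1 + k).
have stepn j : approx (g ^+ j + n.+1%:R) n.+2%:R.
  rewrite -(natr1 n.+1) -ec.
  have -> : g ^+ j + (1 + k + c) = g ^+ j + 1 + k + c by ring.
  rewrite step.
  have -> : 2%:R + k + c = 1 + k + c + 1 by ring.
  exact: approx_refl.
apply: (approx_cancelM (@semifield_natS_neq0 n.+1)).
by rewrite -(arctic_bernoulli _ g1) mulr1; apply: stepn.
Qed.

Lemma ple_cancelD x y k : sim x y -> x + k [<=] y + k -> x [<=] y.
Proof.
move=> xy le; have [//|yx] := F_full xy.
have [x0|x0] := pselect (x = 0).
  by rewrite x0 in xy *; rewrite (sim0 (sim_sym xy)); apply: ple_refl.
have e : approx (y + k) (x + k).
  by split=> //; apply: pleD => //; apply: ple_refl.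
have [x' xx'] := semifield_inv x0.
have yx1 : sim (y * x') 1.
  by rewrite -[in sim _ 1]xx'; apply: simM; [apply: sim_sym|apply: sim_refl].
have e' : approx (y * x') 1.
  apply: (@approx_cancelD1 _ (k * x') yx1).
  by rewrite -mulrDl e mulrDl xx'; apply: approx_refl.
have /(approxM2l x) := e'.
by rewrite mulrCA xx' !mulr1 => -[].
Qed.

Lemma approx_cancelD x y k : sim x y -> approx (x + k) (y + k) -> approx x y.
Proof.
move=> xy [a b]; split; apply: ple_cancelD; eauto.
exact: sim_sym.
Qed.

(** Completing [y] to a natural number [n], one has [x + c = n w] with [w] in the
    class of [1], and [n w ~ w ^ n + (n - 1)] by [arctic_bernoulli]; so
    [g = w ^ n], after cancelling [c]. *)
Lemma sim_approx_shift x y :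
  sim x y -> exists2 g, sim g 1 & approx (x + 1) (y + g).
Proof.
move=> xy; have [c [n ec]] := quasi_complement_approx y.
have [n' nn'] := semifield_inv (@semifield_natS_neq0 n).
set w := (x + c) * n'.
have w1 : sim w 1.
  rewrite /w -[in sim _ 1]nn'; apply: simM; last exact: sim_refl.
  apply: (@sim_trans _ (y + c)); first by apply: simD => //; apply: sim_refl.
  exact: approx_sim.
have g1 := simX1 n.+1 w1; exists (w ^+ n.+1) => //.
apply: (@approx_cancelD _ _ c).
  by apply: simD => //; apply: sim_sym.
have -> : x + 1 + c = (n.+1%:R * n') * (x + c) + 1 by rewrite nn'; ring.
have -> : y + w ^+ n.+1 + c = w ^+ n.+1 + (y + c) by ring.
have -> : n.+1%:R * n' * (x + c) = n.+1%:R * w by rewrite /w; ring.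
rewrite -(arctic_bernoulli _ w1) ec -addrA natr1; exact: approx_refl.
Qed.

(** * The ideal of differences as an ordered group *)

Local Notation A := (groth F).
Local Notation gr := (@gr F).
Implicit Types (a b e : A).

Definition sim_ideal a := exists x y, sim x y /\ a = gr x - gr y.
Definition sim_cone a := exists x y, y [<=] x /\ a = gr x - gr y.

Lemma sim_ideal_sub x y : sim x y -> sim_ideal (gr x - gr y).
Proof. by exists x, y. Qed.

Lemma sim_cone_sub x y : y [<=] x -> sim_cone (gr x - gr y).
Proof. by exists x, y. Qed.

Lemma sim_ideal0 : sim_ideal 0.
Proof. by rewrite -(subrr (gr 0)); apply: sim_ideal_sub; exact: sim_refl. Qed.

Lemma sim_idealD a b : sim_ideal a -> sim_ideal b -> sim_ideal (a + b).
Proof.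
move=> [x [y [xy ->]]] [x' [y' [xy' ->]]].
by rewrite addrACA -opprD -!grD; apply/sim_ideal_sub/simD.
Qed.

Lemma sim_idealN a : sim_ideal a -> sim_ideal (- a).
Proof. by move=> [x [y [xy ->]]]; rewrite opprB; apply/sim_ideal_sub/sim_sym. Qed.

Lemma sim_idealM a b : sim_ideal b -> sim_ideal (a * b).
Proof.
have [s [t ->]] := groth_subP a => -[x [y [xy ->]]].
have -> : (gr s - gr t) * (gr x - gr y) =
    gr (s * x + t * y) - gr (s * y + t * x) by rewrite !grD !grM; ring.
by apply: sim_ideal_sub; apply: simD; apply: simM;
  try exact: sim_refl; try exact: sim_sym.
Qed.

Lemma sim_cone0 : sim_cone 0.
Proof. by rewrite -(subrr (gr 0)); apply: sim_cone_sub; exact: ple_refl. Qed.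

Lemma sim_coneD a b : sim_cone a -> sim_cone b -> sim_cone (a + b).
Proof.
move=> [x [y [xy ->]]] [x' [y' [xy' ->]]].
by rewrite addrACA -opprD -!grD; apply/sim_cone_sub/pleD.
Qed.

Lemma sim_cone_muln a n : sim_cone a -> sim_cone (a *+ n).
Proof.
by move=> Ca; elim: n => [|n IH]; [exact: sim_cone0|rewrite mulrS; exact: sim_coneD].
Qed.

Lemma sim_coneM x a : sim_cone a -> sim_cone (gr x * a).
Proof.
move=> [y [z [yz ->]]]; rewrite mulrBr -!grM; apply: sim_cone_sub.
exact: pleM2l.
Qed.

Lemma sim_cone_ideal a : sim_cone a -> sim_ideal a.
Proof. by move=> [x [y [xy ->]]]; apply/sim_ideal_sub/sim_sym/ple_sim. Qed.

Lemma sim_ideal_total a : sim_ideal a -> sim_cone a \/ sim_cone (- a).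
Proof.
move=> [x [y [/F_full[] le ->]]]; last by left; apply: sim_cone_sub.
by right; rewrite opprB; apply: sim_cone_sub.
Qed.

Lemma sim_cone_ple x y : sim x y -> sim_cone (gr x - gr y) -> y [<=] x.
Proof.
move=> xy [x' [y' [le /gr_sub_eq[k e]]]].
apply: (ple_cancelD (k := y' + k)).
  exact: sim_sym.
rewrite [in X in _ [<=] X]addrA e.
have -> : x' + y + k = y + (x' + k) by ring.
by apply: pleD2l; apply: pleD => //; exact: ple_refl.
Qed.

Lemma sim_cone_approx x y : approx x y -> sim_cone (gr x - gr y).
Proof. by case=> _; apply: sim_cone_sub. Qed.

(** The logarithm to first order: by [arctic_mulD1], [mu] takes products in the
    class of [1] to sums, up to the preorder. *)
Definition mu g : A := gr g - 1.

Lemma sim_ideal_mu a : sim_ideal a ->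
  exists2 g, sim g 1 & sim_cone (a - mu g) /\ sim_cone (mu g - a).
Proof.
move=> [x [y [xy ->]]].
have [g g1 e] := sim_approx_shift xy.
exists g => //; rewrite /mu -gr1.
have -> : gr x - gr y - (gr g - gr 1) = gr (x + 1) - gr (y + g).
  by rewrite !grD; ring.
have -> : gr g - gr 1 - (gr x - gr y) = gr (y + g) - gr (x + 1).
  by rewrite !grD; ring.
by split; apply: sim_cone_approx => //; apply: approx_sym.
Qed.

Lemma mu_exp g n : sim g 1 ->
  sim_cone (mu (g ^+ n) - mu g *+ n) /\ sim_cone (mu g *+ n - mu (g ^+ n)).
Proof.
case: n => [|n] g1.
  by rewrite mulr0n /mu expr0 gr1 subrr subr0; split; exact: sim_cone0.
have e := arctic_bernoulli n g1.
have -> : mu (g ^+ n.+1) - mu g *+ n.+1 = gr (g ^+ n.+1 + n%:R) - gr (n.+1%:R * g).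
  by rewrite grD grM !gr_nat /mu; ring.
have -> : mu g *+ n.+1 - mu (g ^+ n.+1) = gr (n.+1%:R * g) - gr (g ^+ n.+1 + n%:R).
  by rewrite grD grM !gr_nat /mu; ring.
by split; apply: sim_cone_approx => //; apply: approx_sym.
Qed.

Lemma sim_cone_mu g : sim g 1 -> sim_cone (mu g) -> 1 [<=] g.
Proof. by move=> g1; rewrite /mu -gr1; apply: sim_cone_ple. Qed.

Definition mu_unit := mu u.

Lemma sim_u1 : sim u 1.
Proof. by apply/sim_sym/ple_sim; case: u_gt1. Qed.

Lemma sim_cone_unit : sim_cone mu_unit.
Proof. by rewrite /mu_unit /mu -gr1; apply: sim_cone_sub; case: u_gt1. Qed.

Lemma sim_cone_unitN : ~ sim_cone (- mu_unit).
Proof.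
rewrite /mu_unit /mu -gr1 opprB => /sim_cone_ple h; case: u_gt1 => _; apply.
exact/h/sim_sym/sim_u1.
Qed.

Lemma sim_cone_trans b a c :
  sim_cone (a - b) -> sim_cone (b - c) -> sim_cone (a - c).
Proof. by move=> h /(sim_coneD h); rewrite addrA subrK. Qed.

Lemma sim_cone_bounded a : sim_cone a -> exists n, sim_cone (mu_unit *+ n - a).
Proof.
move=> Ca; have [g g1 [ag ga]] := sim_ideal_mu (sim_cone_ideal Ca).
have g_ge1 : 1 [<=] g.
  by apply: sim_cone_mu => //; have := sim_coneD Ca ga; rewrite addrCA subrr addr0.
have g0 := sim_neq0 g1 (@semifield_oner_neq0 F).
have [_ _ /(_ 1 g (@semifield_oner_neq0 F) g0 g_ge1)[n]] := u_univ.
rewrite mul1r => le; exists n; apply: sim_cone_trans ga.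
apply: (@sim_cone_trans (mu (u ^+ n))).
  by have [] := mu_exp n sim_u1.
have -> : mu (u ^+ n) - mu g = gr (u ^+ n) - gr g by rewrite /mu; ring.
exact: sim_cone_sub.
Qed.

(** Replacing [a] by some [mu g], the hypothesis says [g ^ n [<=] u] for all [n],
    and [F] is multiplicatively Archimedean. *)
Lemma sim_cone_arch a : sim_ideal a ->
  (forall n, sim_cone (mu_unit - a *+ n)) -> sim_cone (- a).
Proof.
move=> Ia le; have [g g1 [ag ga]] := sim_ideal_mu Ia.
have g0 := sim_neq0 g1 (@semifield_oner_neq0 F).
have g_le1 : g [<=] 1.
  apply: F_arch g0 u_neq0 _ => n; apply: sim_cone_ple.
    exact: (sim_trans sim_u1 (sim_sym (simX1 _ g1))).
  have -> : gr u - gr (g ^+ n) = mu_unit - mu (g ^+ n) by rewrite /mu_unit /mu; ring.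
  apply: (sim_cone_trans (le n)).
  apply: (@sim_cone_trans (mu g *+ n)); last by have [] := mu_exp n g1.
  by rewrite -mulrnBl; exact: sim_cone_muln.
rewrite -sub0r; apply: (@sim_cone_trans (mu g)) => //.
by rewrite sub0r /mu opprB -gr1; apply: sim_cone_sub.
Qed.

(** * The character and the derivation *)

Definition ell : A -> R := hoelder R sim_cone mu_unit.

Lemma sim_cone_archimedean : archimedean_cone sim_ideal sim_cone mu_unit.
Proof.
split; [exact: sim_idealD|exact: sim_idealN|exact: sim_cone_ideal
  |exact: sim_ideal_total|exact: sim_cone0|exact: sim_coneD|exact: sim_cone_unit
  |exact: sim_cone_unitN|exact: sim_cone_bounded|exact: sim_cone_arch].
Qed.

Lemma ell_add a b : sim_ideal a -> sim_ideal b -> ell (a + b) = ell a + ell b.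
Proof. exact: (hoelderD R sim_cone_archimedean). Qed.

Lemma ell_opp a : sim_ideal a -> ell (- a) = - ell a.
Proof. exact: (hoelderN R sim_cone_archimedean). Qed.

Lemma ell_unit : ell mu_unit = 1.
Proof. exact: (hoelder_unit R sim_cone_archimedean). Qed.

Lemma ell_ge0 a : sim_cone a -> 0 <= ell a.
Proof. exact: (hoelder_ge0 R sim_cone_archimedean). Qed.

Lemma ell_le0 a : sim_ideal a -> ell a <= 0 -> sim_cone (- a).
Proof. exact: (hoelder_le0 sim_cone_archimedean). Qed.

Lemma ell_unique (f : A -> R) a :
  (forall a b, sim_ideal a -> sim_ideal b -> f (a + b) = f a + f b) ->
  (forall a, sim_cone a -> 0 <= f a) -> sim_ideal a -> f a = f mu_unit * ell a.
Proof. exact: (hoelder_unique sim_cone_archimedean). Qed.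

Lemma ell_eq0 a : sim_cone a -> sim_cone (- a) -> ell a = 0.
Proof.
move=> Ca Cna; apply/eqP; rewrite eq_le ell_ge0 // andbT -oppr_ge0.
by rewrite -ell_opp; [exact: ell_ge0|exact: sim_cone_ideal].
Qed.

(** Since [ell mu_unit = 1], this is the only candidate for the scalar by which
    [a] acts on [ell]; [ell_mul] shows that it does. *)
Definition phi a : R := ell (a * mu_unit).

Lemma ell_mul a b : sim_ideal b -> ell (a * b) = phi a * ell b.
Proof.
have key x c : sim_ideal c -> ell (gr x * c) = phi (gr x) * ell c.
  move=> Ic; rewrite (@ell_unique (fun c => ell (gr x * c))) //.
    by move=> *; rewrite mulrDr ell_add //; apply: sim_idealM.
  by move=> *; apply/ell_ge0/sim_coneM.
move=> Ib; have [x [y ->]] := groth_subP a.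
have Iu := sim_cone_ideal sim_cone_unit.
rewrite /phi !mulrBl !ell_add ?ell_opp ?key //; try exact: sim_idealM;
  try by apply/sim_idealN/sim_idealM.
by rewrite ell_unit; ring.
Qed.

Lemma phiD a b : phi (a + b) = phi a + phi b.
Proof.
by rewrite /phi mulrDl ell_add //; apply/sim_idealM/sim_cone_ideal/sim_cone_unit.
Qed.

Lemma phi1 : phi 1 = 1.
Proof. by rewrite /phi mul1r ell_unit. Qed.

Lemma phiM a b : phi (a * b) = phi a * phi b.
Proof.
by rewrite {1}/phi -mulrA ell_mul //; apply/sim_idealM/sim_cone_ideal/sim_cone_unit.
Qed.

Lemma phi0 : phi 0 = 0.
Proof. by have := phiD 0 0; rewrite addr0; lra. Qed.

Lemma phiN a : phi (- a) = - phi a.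
Proof. by have := phiD a (- a); rewrite subrr phi0; lra. Qed.

Lemma phi_ge0 x : 0 <= phi (gr x).
Proof. by apply/ell_ge0/sim_coneM/sim_cone_unit. Qed.

Lemma phi_gt0 x : x <> 0 -> 0 < phi (gr x).
Proof.
move=> /semifield_inv[x' xx']; rewrite lt_def phi_ge0 andbT; apply/eqP => e.
have := phiM (gr x) (gr x'); rewrite -grM xx' gr1 phi1 e mul0r.
by move/eqP; rewrite oner_eq0.
Qed.

(** Modulo elements that [ell] kills, [a] is some [mu g], and
    [mu g * mu u = g u + 1 - (g + u)] is killed by [ell] by [arctic_mulD1]. *)
Lemma phi_ideal a : sim_ideal a -> phi a = 0.
Proof.
move=> Ia; have [g g1 [ag ga]] := sim_ideal_mu Ia.
have Iu := sim_cone_ideal sim_cone_unit.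
have Id : sim_ideal (a - mu g) by apply: sim_cone_ideal.
have d0 : ell (a - mu g) = 0 by apply: ell_eq0 => //; rewrite opprB.
have e := arctic_mulD1 g1 sim_u1.
have m0 : ell (mu g * mu_unit) = 0.
  have -> : mu g * mu_unit = gr (g * u + 1) - gr (g + u).
    by rewrite !grD grM gr1 /mu_unit /mu; ring.
  by apply: ell_eq0; rewrite ?opprB; apply: sim_cone_approx => //; apply: approx_sym.
have -> : a = (a - mu g) + mu g by rewrite subrK.
rewrite phiD /phi m0 addr0 mulrC ell_mul // d0 mulr0; done.
Qed.

Hypothesis F_fields : finite_product_of_fields (groth (sim_quot F)).

(** The ideal is the kernel of [A -> groth (sim_quot F)], whose target is von
    Neumann regular; the computation is done on representing pairs. *)
Lemma groth_regular_mod a : exists b, sim_ideal (a * a * b - a).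
Proof.
elim/quotW: a => -[x y]; pose pi z := \pi_(sim_quot F) z.
have [b' e] := product_of_fields_regular
  (\pi_(groth (sim_quot F)) (pi x, pi y)) F_fields.
elim/quotW: b' e => -[z' w']; elim/quotW: z' => z; elim/quotW: w' => w e.
pose q : F * F := (x, y); pose r : F * F := (z, w).
exists (\pi_(groth F) r).
pose p := pr_mul (pr_mul q q) r.
have eF : \pi_(groth F) q * \pi_(groth F) q * \pi_(groth F) r = \pi_(groth F) p.
  by rewrite -!gr_mulE.
have : \pi_(groth (sim_quot F)) (pi p.1, pi p.2) = \pi_(groth (sim_quot F)) (pi x, pi y).
  rewrite -e; transitivity (\pi_(groth (sim_quot F))
    (pr_mul (pr_mul (pi x, pi y) (pi x, pi y)) (pi z, pi w))).
    by congr (\pi_(groth (sim_quot F)) _); rewrite /p /pr_mul /pi /= !(sim_piD, sim_piM).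
  by rewrite -!gr_mulE.
move=> /gr_piP[k' /=]; elim/quotW: k' => k; rewrite -!sim_piD => /sim_piP s.
rewrite -[X in _ - X]/(\pi_(groth F) q) eF (surjective_pairing p) !gr_pairE.
have -> : gr p.1 - gr p.2 - (gr q.1 - gr q.2) =
   gr (p.1 + y + k) - gr (x + p.2 + k) by rewrite !grD /=; ring.
exact: sim_ideal_sub.
Qed.

Lemma kernel_regular a : exists b, phi a = 0 ->
  sim_ideal ((1 - a * b) * a) /\ phi (1 - a * b) = 1.
Proof.
have [b Ib] := groth_regular_mod a; exists b => a0; split.
  by rewrite -opprB mulNr; apply: sim_idealN; rewrite mulrBl mul1r mulrAC.
by rewrite phiD phiN phiM a0 mul0r oppr0 addr0 phi1.
Qed.

Lemma phi_inv a : phi a <> 0 -> exists b, phi a * phi b = 1.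
Proof.
move=> a0; have [b /phi_ideal] := groth_regular_mod a.
rewrite phiD phiN !phiM => e; exists b.
apply: (mulfI (introN eqP a0)); rewrite mulrA mulr1.
by apply/eqP; rewrite -subr_eq0; apply/eqP.
Qed.

(** For [a] in the kernel of [phi], regularity gives [e] with [phi e = 1] and
    [e a] in the ideal.  The value [ell (e a)] is forced by linearity, and it is
    the same for all such [e], since [ell (e' (e a)) = ell (e (e' a))]. *)
Lemma ell_extends : exists2 l : A -> R, forall a, sim_ideal a -> l a = ell a &
  (forall a b, phi a = 0 -> phi b = 0 -> l (a + b) = l a + l b) /\
  (forall a b, phi b = 0 -> l (a * b) = phi a * l b).
Proof.
have /choice[r rP] := kernel_regular.
pose l a := ell ((1 - a * r a) * a).
have lE a e : phi a = 0 -> phi e = 1 -> sim_ideal (e * a) -> l a = ell (e * a).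
  move=> a0 e1 Iea; have [Ia ra1] := rP a a0.
  by rewrite -[LHS]mul1r -e1 -[RHS]mul1r -ra1 -!ell_mul // mulrCA.
exists l => [a Ia|].
  by rewrite (lE a 1) ?mul1r ?phi1 //; exact: phi_ideal.
split=> a b.
  move=> a0 b0; have [Ia ra1] := rP a a0; have [Ib rb1] := rP b b0.
  set s := 1 - a * r a in Ia ra1 *; set t := 1 - b * r b in Ib rb1 *.
  have st1 : phi (s * t) = 1 by rewrite phiM ra1 rb1 mulr1.
  have sa : sim_ideal (s * t * a) by rewrite mulrAC mulrC; apply: sim_idealM.
  have tb : sim_ideal (s * t * b) by rewrite -mulrA; apply: sim_idealM.
  rewrite (lE a (s * t)) // (lE b (s * t)) // -ell_add // -mulrDr; apply: lE => //.
    by rewrite phiD a0 b0 addr0.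
  by rewrite mulrDr; apply: sim_idealD.
move=> b0; have [Ib rb1] := rP b b0.
rewrite -[l b]/(ell _) -ell_mul // mulrCA; apply: lE => //.
  by rewrite phiM b0 mulr0.
by rewrite mulrCA; apply: sim_idealM.
Qed.

(** The hypothesis on [S] is that [phi] embeds it, so it is a lift ring whatever
    the extension of [ell] to the kernel. *)
Lemma scalar_derivation (S : set A) :
  S 1 -> (forall a b, S a -> S b -> S (a - b)) ->
  (forall a b, S a -> S b -> S (a * b)) ->
  (forall a, S a -> phi a = 0 -> a = 0) ->
  exists D : A -> R, [/\ forall a b, D (a + b) = D a + D b,
    forall a b, D (a * b) = phi a * D b + phi b * D a,
    forall a, sim_ideal a -> D a = ell a & forall a, S a -> D a = 0].
Proof.
move=> S1 SB SM S0; have [l lI [lD lM]] := ell_extends.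
have A10 : (1 : A) != 0.
  by apply/eqP => e; have := phi1; rewrite e phi0 => /esym/eqP; rewrite oner_eq0.
pose A' : comNzRingType := HB.pack A (GRing.PzSemiRing_isNonZero.Build A A10).
have h0 : nmod_morphism (phi : A' -> R) by split; [exact: phi0|exact: phiD].
have h1 : monoid_morphism (phi : A' -> R) by split; [exact: phi1|exact: phiM].
pose f : {rmorphism A' -> R} := HB.pack (phi : A' -> R)
  (GRing.isNmodMorphism.Build A' R phi h0) (GRing.isMonoidMorphism.Build A' R phi h1).
have SL : @lift_ring A' R f l S.
  split=> // a Sa a0; rewrite (S0 a Sa a0) lI; last exact: sim_ideal0.
  by have := ell_add sim_ideal0 sim_ideal0; rewrite addr0; lra.
have [D [DD DM Dl DS]] := @derivation_extension A' R f l lD lM phi_inv S SL.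
exists D; split=> // a Ia; rewrite -lI //; apply: Dl; exact: phi_ideal.
Qed.

Lemma representation_exists (S : set A) :
  S 1 -> (forall a b, S a -> S b -> S (a - b)) ->
  (forall a b, S a -> S b -> S (a * b)) ->
  (forall a, S a -> phi a = 0 -> a = 0) ->
  exists psi : {rmorphism F -> linpoly R},
    (forall x y, sim x y -> (x [<=] y <-> psi x [<=] psi y)) /\
    (forall x, (val (psi x))`_0 = phi (gr x) /\
      (S (gr x) -> (val (psi x))`_1 = 0)).
Proof.
move=> S1 SB SM S0; have [D [DD DM DI DS]] := scalar_derivation S1 SB SM S0.
have DB a b : D (a - b) = D a - D b.
  by have := DD (a - b) b; rewrite subrK; lra.
have [||||||psi psiP] := @linpoly_hom_exists R F (phi \o gr) (D \o gr).
- by move=> x; exact: phi_gt0.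
- by move=> x y /=; rewrite grD phiD.
- by move=> x y /=; rewrite grM phiM.
- by rewrite /= gr1 phi1.
- by move=> x y /=; rewrite grD DD.
- by move=> x y /=; rewrite grM DM.
exists psi; split=> [x y xy|x]; last first.
  by have [-> ->] := psiP x; split=> // /DS.
have [x0 x1] := psiP x; have [y0 y1] := psiP y.
have Ixy : sim_ideal (gr x - gr y) by apply: sim_ideal_sub.
have De : D (gr x) - D (gr y) = ell (gr x - gr y) by rewrite -DB DI.
have eq0 : phi (gr x) = phi (gr y).
  by have := phi_ideal Ixy; rewrite phiD phiN; lra.
have iff : x [<=] y <-> D (gr x) <= D (gr y).
  rewrite -subr_le0 De; split=> [le|/(ell_le0 Ixy)].
    rewrite -oppr_ge0 -ell_opp // opprB; exact/ell_ge0/sim_cone_sub.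
  by rewrite opprB; apply: sim_cone_ple; apply: sim_sym.
split=> [/iff le|[_]].
  by split; rewrite ?x0 ?y0 ?x1 ?y1.
by rewrite x1 y1 => /iff.
Qed.

End Representation.

Theorem proposition6p8 (R : realType) (F : preorderedSemifieldType) (u : F)
  (F_arch : mult_archimedean F)
  (F_full : fully_preordered F)
  (u_univ : power_universal u)
  (u_gt1 : 1 [<] u)
  (F_arctic : arctic F)
  (F_qcompl : quasi_complements (sim_quot F))
  (F_fields : finite_product_of_fields (groth (sim_quot F))) :
  (exists psi : {rmorphism F -> linpoly R},
     forall x y : F, sim x y -> (x [<=] y <-> psi x [<=] psi y)) /\
  (forall scal : nnreal R -> F -> F, is_semialgebra scal ->
     exists psi : {rmorphism F -> linpoly R},
       (forall x y : F, sim x y -> (x [<=] y <-> psi x [<=] psi y)) /\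
       (forall (r : nnreal R) (x : F), psi (scal r x) = linpoly_scale r (psi x))).
Proof.
have repr := representation_exists (R := R) F_arch F_full u_univ u_gt1
  F_arctic F_qcompl F_fields.
have phD := phiD R F_arch F_full u_univ u_gt1 F_arctic F_qcompl.
have phN := phiN R F_arch F_full u_univ u_gt1 F_arctic F_qcompl.
have ph1 := phi1 R F_arch F_full u_univ u_gt1 F_arctic F_qcompl.
have ph0 := phi0 R F_arch F_full u_univ u_gt1 F_arctic F_qcompl.
split.
  have [||||psi [psiP _]] := repr (fun a => exists z : int, a = z%:~R);
    last by exists psi.
  - by exists 1.
  - by move=> _ _ [z ->] [t ->]; exists (z - t); rewrite intrB.
  - by move=> _ _ [z ->] [t ->]; exists (z * t); rewrite intrM.
  - have phn n : phi R u (n%:R : groth F) = n%:R.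
      by elim: n => [|n IH]; rewrite ?ph0 // -!natr1 phD IH ph1.
    move=> _ [[n|n] ->]; rewrite ?NegzE ?mulrNz -?pmulrn ?phN phn.
      by move/eqP; rewrite pnatr_eq0 => /eqP->.
    by move/eqP; rewrite oppr_eq0 pnatr_eq0.
move=> scal sc; pose iota r := scal r 1.
have iotaM r s : iota (r * s) = iota r * iota s by rewrite /iota (scalM sc) mulr1.
have iotaD r s : iota (r + s) = iota r + iota s by rewrite /iota (scalDl sc).
have scalE r x : scal r x = iota r * x.
  by rewrite -[in RHS](scal1 sc x) /iota (scalM sc) mulr1 mul1r.
have phi_iota r : phi R u (gr (iota r)) = val r.
  apply: (nnreal_additive_id (f := fun r => phi R u (gr (iota r)))).
  - by move=> s t; rewrite iotaD grD phD.
  - by move=> s; exact: phi_ge0.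
  - by rewrite /iota (scal1 sc) gr1 ph1.
have [||||psi [psiP psiE]] :=
    repr (fun a => exists r s, a = gr (iota r) - gr (iota s)).
- by exists 1, 0; rewrite /iota (scal1 sc) (scal0l sc) gr0 subr0.
- move=> _ _ [r [s ->]] [r' [s' ->]]; exists (r + s'), (s + r').
  by rewrite !iotaD !grD; ring.
- move=> _ _ [r [s ->]] [r' [s' ->]]; exists (r * r' + s * s'), (r * s' + s * r').
  by rewrite !iotaD !iotaM !grD !grM; ring.
- move=> _ [r [s ->]]; rewrite phD phN !phi_iota => /eqP; rewrite subr_eq0.
  by move=> /eqP/val_inj ->; rewrite subrr.
exists psi; split=> // r x; rewrite scalE rmorphM.
have [p0 p1] := psiE (iota r).
have {}p1 : (val (psi (iota r)))`_1 = 0.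
  by apply: p1; exists r, 0; rewrite /iota (scal0l sc) gr0 subr0.
apply: val_inj; rewrite rmorphM /=; apply: dualP.
  by rewrite dualM0 dualZ p0 phi_iota.
by rewrite dualM1 dualZ p0 p1 phi_iota mul0r addr0.
Qed.
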